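(* Suppose that $X$ is a finite set. Then the structure space $\Pi_{\ell^1}$ of $\ell^1(\Sigma)$ is homeomorphic to the topological disjoint union of copies of $\mathbb{T}$, one for each orbit in $X$.
   Context: $X$ is a non-empty compact Hausdorff space, $\sigma:X\to X$ is a homeomorphism, $\Sigma=(X,\sigma)$, and $\mathbb{Z}$ acts on $X$ via $n\mapsto\sigma^n$; orbits are orbits of this action. $\mathbb{T}$ is the unit circle in $\mathbb{C}$. $C(X)$ carries the supremum norm and $\alpha(f)=f\circ\sigma^{-1}$. $\ell^1(\Sigma)$ is the Banach space of all $a:\mathbb{Z}\to C(X)$ with $\|a\|=\sum_n\|a(n)\|<\infty$, with multiplication $(aa')(n)=\sum_{k\in\mathbb{Z}}a(k)\,\alpha^k(a'(n-k))$; it is a unital Banach algebra. A representation of an algebra $A$ on a complex vector space $E$ is algebraically irreducible if $\pi(A)E\ne\{0\}$ and the only invariant subspaces are $\{0\}$ and $E$; a primitive ideal is the kernel of such a representation. The structure space $\Pi_{\ell^1}$ of $\ell^1(\Sigma)$ is the set of all its primitive ideals with the hull-kernel topology: the closure of $E\subset\Pi_{\ell^1}$ is $\{P\in\Pi_{\ell^1}:P\supset\bigcap_{Q\in E}Q\}$. *)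

(* Defs.v *)
From HB Require Import structures.
From mathcomp Require Import all_boot all_order all_algebra finmap.
From mathcomp Require Import all_classical all_reals all_analysis.
From mathcomp Require Import complex ring lra.
From mathcomp Require summability.

Set Implicit Arguments.
Unset Strict Implicit.
Unset Printing Implicit Defensive.

Import Order.TTheory GRing.Theory Num.Theory numFieldNormedType.Exports.

Local Open Scope classical_set_scope.
Local Open Scope ring_scope.
Local Open Scope complex_scope.

(* The `numClosedFieldType` ascription is what triggers the norm, topology and
   normed module structures of the complex numbers. *)
Definition Cplx (R : realType) : numClosedFieldType := R[i].

Definition circle (R : realType) : set (Cplx R) := [set z | `|z| = 1].
Arguments circle R : clear implicits.

Record homeomorphism (T U : topologicalType) := Homeomorphism {
  hfun :> T -> U;
  hinv : U -> T;
  hfunK : cancel hfun hinv;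
  hinvK : cancel hinv hfun;
  hfun_continuous : continuous hfun;
  hinv_continuous : continuous hinv }.

Definition homeomorphic (T U : topologicalType) : Prop :=
  inhabited (homeomorphism T U).

Record dynSystem := DynSystem {
  space :> topologicalType;
  space_nonempty : [set: space] !=set0;
  space_compact : compact [set: space];
  space_hausdorff : hausdorff_space space;
  sigma : homeomorphism space space }.

Section zpow.
Variables (T : topologicalType) (h : homeomorphism T T).

(* The action of the integers generated by h: `zpow n` is h^n. *)
Definition zpow (n : int) : T -> T :=
  match n with
  | Posz k => iter k h
  | Negz k => iter k.+1 (hinv h)
  end.

Lemma zpow0 x : zpow 0 x = x. Proof. by []. Qed.

Lemma zpowS n x : zpow (n + 1) x = h (zpow n x).
Proof.
case: n => [n|[|n]].
- by rewrite -PoszD addn1.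
- by rewrite /= hinvK.
- have -> : Negz n.+1 + 1 = Negz n.
    by rewrite !NegzE -(addn1 n.+1) PoszD opprD addrNK.
  by rewrite /= hinvK.
Qed.

Lemma zpowD m n x : zpow (m + n) x = zpow m (zpow n x).
Proof.
elim/int_rect: m => [|m IH|m IH].
- by rewrite add0r.
- by rewrite -addn1 PoszD addrAC !zpowS IH.
- apply: (can_inj (hfunK h)).
  by rewrite -!zpowS -addn1 PoszD opprD addrAC !addrNK IH.
Qed.

Lemma zpow_continuous n : continuous (zpow n).
Proof.
have it (g : T -> T) k : continuous g -> continuous (iter k g).
  move=> cg; elim: k => [|k IH] x; first exact: cvg_id.
  exact: (continuous_comp (IH x) (cg _)).
by case: n => k; apply: it; [exact: hfun_continuous|exact: hinv_continuous].
Qed.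

Definition zorbit (x : T) : set T := range (zpow^~ x).

End zpow.

Definition orbit_space (S : dynSystem) := set_type (range (zorbit (sigma S))).
HB.instance Definition _ S := gen_eqMixin (orbit_space S).
HB.instance Definition _ S := gen_choiceMixin (orbit_space S).

Section absC.
Variable R : realType.
Local Notation C := (Cplx R).

(* The modulus, as an element of R instead of R[i]. *)
Definition absC (z : C) : R := complex.Re `|z|.

Lemma absCE (z : C) : (absC z)%:C = `|z|.
Proof. by rewrite /absC; apply: RRe_real; exact: normr_real. Qed.

Lemma absC_ge0 z : 0 <= absC z.
Proof. by rewrite -lecR absCE normr_ge0. Qed.

Lemma absCD y z : absC (y + z) <= absC y + absC z.
Proof. by rewrite -lecR rmorphD /= !absCE ler_normD. Qed.

Lemma absCM y z : absC (y * z) = absC y * absC z.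
Proof. by apply: (complexI); rewrite rmorphM /= !absCE normrM. Qed.

Lemma absC_eq0 z : absC z = 0 -> z = 0.
Proof. by move=> z0; apply/normr0_eq0; rewrite -absCE z0. Qed.

Lemma absC_continuous : continuous absC.
Proof.
move=> z; apply/(@cvgrPdist_lt _ _ _ (nbhs z) (nbhs_filter z)) => e e0.
have e0C : (0 : C) < e%:C by rewrite ltcR.
apply: (@filterS _ (nbhs z) (nbhs_filter z) _ _ _ (nbhsx_ballx z _ e0C)) => w.
rewrite -ball_normE /ball_ /= -absCE ltcR => /le_lt_trans; apply.
rewrite ler_distlC; apply/andP; split.
  by rewrite lerBlDr (le_trans _ (absCD _ _))// addrC subrK.
rewrite -[leLHS]/(absC w) -{1}(subrK z w) (le_trans (absCD _ _))// addrC.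
by rewrite lerD2l -lecR !absCE distrC.
Qed.
End absC.

Section cfun.
Variables (R : realType) (S : dynSystem).
Local Notation C := (Cplx R).

Definition contf : {pred S -> C} := fun f => `[< continuous f >].

Lemma contfP (f : S -> C) : reflect (continuous f) (f \in contf).
Proof. exact: asboolP. Qed.

(* The algebra C(X), with the supremum norm. *)
Record cfun := CFun { cfun_val :> S -> C; _ : cfun_val \in contf }.

HB.instance Definition _ := [isSub for cfun_val].
HB.instance Definition _ := [Choice of cfun by <:].

Lemma cfun_continuous (f : cfun) : continuous f.
Proof. by apply/contfP; case: f. Qed.

Lemma contf_subring : subring_closed contf.
Proof.
split=> [|f g /contfP cf /contfP cg|f g /contfP cf /contfP cg]; apply/contfP.
- by move=> x; exact: cvg_cst.
- by move=> x; exact: (cvgB (cf x) (cg x)).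
- by move=> x; exact: (cvgM (cf x) (cg x)).
Qed.

Lemma contf_submod : submod_closed contf.
Proof.
split=> [|c f g /contfP cf /contfP cg]; apply/contfP => x; first exact: cvg_cst.
exact: (cvgD (cvgM (cvg_cst c) (cf x)) (cg x)).
Qed.

HB.instance Definition _ :=
  GRing.SubChoice_isSubComPzRing.Build (S -> C) contf cfun contf_subring.
HB.instance Definition _ :=
  GRing.SubZmodule_isSubLmodule.Build C (S -> C) contf cfun contf_submod.

Lemma cfunP (f g : cfun) : (forall x, f x = g x) -> f = g.
Proof. by move=> fg; apply/val_inj/funext. Qed.

Lemma cfun0E x : (0 : cfun) x = 0. Proof. by []. Qed.
Lemma cfunDE (f g : cfun) x : (f + g) x = f x + g x. Proof. by []. Qed.
Lemma cfunNE (f : cfun) x : (- f) x = - f x. Proof. by []. Qed.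
Lemma cfunBE (f g : cfun) x : (f - g) x = f x - g x. Proof. by []. Qed.
Lemma cfunME (f g : cfun) x : (f * g) x = f x * g x. Proof. by []. Qed.
Lemma cfunZE (c : C) (f : cfun) x : (c *: f) x = c * f x. Proof. by []. Qed.
Lemma cfun1E x : (1 : cfun) x = 1. Proof. by []. Qed.

Definition supnorm (f : cfun) : R := sup (range (fun x => absC (f x))).

Lemma supnorm_has_sup (f : cfun) : has_sup (range (fun x => absC (f x))).
Proof.
split; first by case: (space_nonempty S) => x _; exists (absC (f x)), x.
have cf : continuous (fun x => absC (f x)).
  move=> x; exact: (continuous_comp (cfun_continuous (x := x)) (@absC_continuous _ _)).
have /compact_bounded : compact (range (fun x => absC (f x))).
  apply: continuous_compact; last exact: space_compact.
  exact: continuous_subspaceT.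
case=> M [_ /(_ (M + 1))]; rewrite ltrDl ltr01 => /(_ isT) bM.
by exists (M + 1) => y /bM; apply: le_trans; exact: ler_norm.
Qed.

Lemma le_supnorm (f : cfun) x : absC (f x) <= supnorm f.
Proof. by apply: ub_le_sup; [case: (supnorm_has_sup f)|exists x]. Qed.

Lemma supnorm_le (f : cfun) M : (forall x, absC (f x) <= M) -> supnorm f <= M.
Proof.
move=> fM; apply: ge_sup; first by case: (supnorm_has_sup f).
by move=> _ [x _ <-].
Qed.

Lemma supnorm_ge0 f : 0 <= supnorm f.
Proof.
case: (space_nonempty S) => x _.
exact: (le_trans (absC_ge0 _) (le_supnorm f x)).
Qed.

Lemma supnormD f g : supnorm (f + g) <= supnorm f + supnorm g.
Proof.
apply: supnorm_le => x; apply: (le_trans (absCD _ _)).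
by apply: lerD; exact: le_supnorm.
Qed.

Lemma supnormM f g : supnorm (f * g) <= supnorm f * supnorm g.
Proof.
apply: supnorm_le => x; rewrite absCM.
by apply: ler_pM; rewrite ?absC_ge0 ?le_supnorm.
Qed.

Lemma supnormZ (c : C) f : supnorm (c *: f) = absC c * supnorm f.
Proof.
have le_ (d : C) g : supnorm (d *: g) <= absC d * supnorm g.
  apply: supnorm_le => x; rewrite cfunZE absCM ler_wpM2l ?absC_ge0//.
  exact: le_supnorm.
apply/eqP; rewrite eq_le le_ /=.
have [->|c0] := eqVneq c 0.
  by rewrite /absC normr0 /= mul0r supnorm_ge0.
have c_gt0 : 0 < absC c.
  by rewrite lt_def absC_ge0 andbT; apply: contra_neq c0 => /absC_eq0.
rewrite -ler_pdivlMl// -{1}(scale1r f) -(mulVf c0) -scalerA.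
apply: (le_trans (le_ _ _)); rewrite ler_wpM2r ?supnorm_ge0//.
rewrite -(ler_pM2r c_gt0) -absCM mulVf ?c0// mulVf ?gt_eqF//.
by rewrite /absC normr1.
Qed.

Lemma supnorm_eq0 f : supnorm f = 0 -> f = 0.
Proof.
move=> f0; apply: cfunP => x; apply: absC_eq0; apply/eqP.
by rewrite eq_le absC_ge0 andbT -f0 le_supnorm.
Qed.

Let norm (f : cfun) : C := (supnorm f)%:C.

Let normD f g : norm (f + g) <= norm f + norm g.
Proof. by rewrite /norm -rmorphD /= lecR supnormD. Qed.

Let normZ (c : C) f : norm (c *: f) = `|c| * norm f.
Proof. by rewrite /norm supnormZ rmorphM /= absCE. Qed.

Let norm_eq0 f : norm f = 0 -> f = 0.
Proof. by move=> /complexI/supnorm_eq0. Qed.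

HB.instance Definition _ := Lmodule_isNormed.Build C cfun normD normZ norm_eq0.

Lemma cfun_normE (f : cfun) : `|f| = (supnorm f)%:C.
Proof. by []. Qed.

End cfun.

Section rnorm.
Variables (R : realType).
Local Notation C := (Cplx R).

Lemma gt0C (e : C) : 0 < e -> exists2 r : R, 0 < r & e = r%:C.
Proof.
move=> e0; exists (complex.Re e); last by rewrite RRe_real// realE ltW.
by rewrite -ltcR RRe_real// realE ltW.
Qed.

Variable V : normedModType C.

(* The norm, as an element of R instead of R[i]. *)
Definition rnorm (v : V) : R := complex.Re `|v|.

Lemma rnormE (v : V) : (rnorm v)%:C = `|v|.
Proof. by rewrite /rnorm; apply: RRe_real; exact: normr_real. Qed.

Lemma rnorm_ge0 v : 0 <= rnorm v.
Proof. by rewrite -lecR rnormE normr_ge0. Qed.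

Lemma rnorm0 : rnorm 0 = 0.
Proof. by rewrite /rnorm normr0. Qed.

Lemma rnormN v : rnorm (- v) = rnorm v.
Proof. by rewrite /rnorm normrN. Qed.

Lemma rnormD u v : rnorm (u + v) <= rnorm u + rnorm v.
Proof. by rewrite -lecR rmorphD /= !rnormE ler_normD. Qed.

Lemma rnorm_eq0 v : rnorm v = 0 -> v = 0.
Proof. by move=> v0; apply/normr0_eq0; rewrite -rnormE v0. Qed.

Lemma rnorm_fcvgP (F : set_system V) (l : V) : Filter F ->
  F --> l <-> (forall e : R, 0 < e -> \forall v \near F, rnorm (l - v) < e).
Proof.
move=> FF; split=> [/fcvgrPdist_lt h e e0|h].
  have e0C : (0 : C) < e%:C by rewrite ltcR.
  by apply: filterS (h _ e0C) => v; rewrite -rnormE ltcR.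
apply/fcvgrPdist_lt => _ /gt0C[e e0 ->].
by apply: filterS (h _ e0) => v; rewrite -rnormE ltcR.
Qed.

Lemma rnorm_cauchy (F : set_system V) : ProperFilter F -> cauchy F ->
  forall e : R, 0 < e -> exists v, \forall u \near F, rnorm (v - u) < e.
Proof.
move=> FF /cauchyP cF e e0; have e0C : (0 : C) < e%:C by rewrite ltcR.
have [v Fv] := cF _ e0C; exists v; apply: filterS Fv => u.
by rewrite -ball_normE /= -rnormE ltcR.
Qed.

Lemma cauchy_rnorm (F : set_system V) : ProperFilter F ->
  (forall e : R, 0 < e -> exists v, \forall u \near F, rnorm (v - u) < e) ->
  cauchy F.
Proof.
move=> FF h; apply/cauchyP => _ /gt0C[e e0 ->].
have [v Fv] := h _ e0; exists v; apply: filterS Fv => u.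
by rewrite -ball_normE /= -rnormE ltcR.
Qed.

End rnorm.

Section complete.
Variables (R : realType).
Local Notation C := (Cplx R).

Lemma absC_ReIm (z : C) :
  [/\ `|complex.Re z| <= absC z, `|complex.Im z| <= absC z
    & absC z <= `|complex.Re z| + `|complex.Im z|].
Proof.
have ReP (w : R[i]) : `|complex.Re w| <= absC (w : C).
  by rewrite -lecR absCE; exact: normc_ge_Re.
have absCi : absC ('i : C) = 1.
  by rewrite /absC normc_def /= expr0n /= add0r expr1n sqrtr1.
split; first exact: ReP.
  have := ReP (z * 'i); rewrite ReiNIm normrN => /le_trans; apply.
  by rewrite [leLHS](absCM z 'i) absCi mulr1.
rewrite {1}[z]complexE; apply: (le_trans (absCD _ _)).
rewrite lerD//; first by rewrite /absC normc_def /= expr0n addr0 sqrtr_sqr.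
rewrite [leLHS](absCM ('i : C)) absCi mul1r.
by rewrite /absC normc_def /= expr0n addr0 sqrtr_sqr.
Qed.

Lemma Cplx_complete (F : set_system C) : ProperFilter F ->
  (forall e : R, 0 < e -> exists v, \forall u \near F, absC (v - u) < e) ->
  exists l, forall e : R, 0 < e -> \forall v \near F, absC (l - v) < e.
Proof.
move=> FF cF.
have cvR (f : C -> R) : (forall y z, `|f y - f z| <= absC (y - z)) ->
    cvg (f @ F).
  move=> fl; apply: cauchy_cvg; apply/cauchyP => e e0.
  have [v Fv] := cF _ e0; exists (f v); apply: filterS Fv => u.
  by rewrite -ball_normE /=; apply: le_lt_trans; exact: fl.
have /cvg_ex[a /cvgrPdist_lt Fa] : cvg ((fun z : C => complex.Re z) @ F).
  apply: cvR => y z; rewrite -raddfB.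
  by case: (absC_ReIm (y - z)).
have /cvg_ex[b /cvgrPdist_lt Fb] : cvg ((fun z : C => complex.Im z) @ F).
  apply: cvR => y z; rewrite -raddfB.
  by case: (absC_ReIm (y - z)).
exists (a +i* b : C) => e e0.
have e2 : 0 < e / 2 by rewrite divr_gt0.
have := Fb _ e2; have := Fa _ e2; apply: filterS2 => z /= za zb.
have [_ _ /le_lt_trans->//] := absC_ReIm ((a +i* b : C) - z).
rewrite !raddfB /= (splitr e); exact: ltrD.
Qed.

Variable S : dynSystem.

Lemma supnorm_rnorm (f : cfun R S) : supnorm f = rnorm f.
Proof. by apply: complexI; rewrite rnormE. Qed.

Lemma cfun_complete (F : set_system (cfun R S)) :
  ProperFilter F -> cauchy F -> cvg F.
Proof.
move=> FF cF.
have cu (e : R) : 0 < e -> exists v : cfun R S,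
    F [set u : cfun R S | forall x, absC (v x - u x) < e].
  move=> e0; have [v Fv] := rnorm_cauchy FF cF e0; exists v.
  apply: filterS Fv => u; rewrite -supnorm_rnorm => + x.
  by apply: le_lt_trans; exact: (le_supnorm (v - u) x).
have /choice[g Fg] : forall x, exists l : C, forall e : R, 0 < e ->
    F [set u : cfun R S | absC (l - u x) < e].
  move=> x; apply: (@Cplx_complete ((fun u : cfun R S => u x) @ F)) => e e0.
  by have [v Fv] := cu _ e0; exists (v x); change (F [set u : cfun R S | absC (v x - u x) < e]); apply: filterS Fv => u vu; exact: vu.
have gu (e : R) : 0 < e -> exists v : cfun R S,
    (forall x, absC (g x - v x) <= e) /\
    F [set u : cfun R S | forall x, absC (v x - u x) < e].
  move=> e0; have [v Fv] := cu _ e0; exists v; split=> // x.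
  apply/ler_addgt0Pr => d d0; have := Fg x _ d0.
  move=> /(filterI Fv)/filter_ex[u [/(_ x) vu gu]].
  rewrite -(subrKA (u x)) (le_trans (absCD _ _))// addrC lerD ?ltW//.
  by rewrite /absC distrC -/(absC _).
have cg : continuous g.
  move=> x; apply/(@cvgrPdist_lt _ _ _ (nbhs x)) => _ /gt0C[e e0 ->].
  have e3 : 0 < e / 3 by rewrite divr_gt0.
  have [v [gv _]] := gu _ e3.
  have /(@cvgrPdist_lt _ _ _ (nbhs x)) := @cfun_continuous _ _ v x.
  move=> /(_ (e / 3)%:C); rewrite ltcR => /(_ e3); apply: filterS => y.
  rewrite -!absCE !ltcR => vxy.
  rewrite -(subrKA (v x)) (le_lt_trans (absCD _ _))//.
  have -> : e = e / 3 + (e / 3 + e / 3) by lra.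
  rewrite ler_ltD// -(subrKA (v y)) (le_lt_trans (absCD _ _))// ltr_leD//.
  by rewrite /absC distrC -/(absC _).
pose G := CFun (introT (contfP _) cg); apply/cvg_ex; exists G.
apply/rnorm_fcvgP => e e0; have e2 : 0 < e / 2 by rewrite divr_gt0.
have e3 : e / 2 + e / 2 = e by rewrite -splitr.
have [v [gv Fv]] := gu _ (divr_gt0 e2 (ltr0n R 2)).
apply: filterS Fv => u vu; rewrite -supnorm_rnorm -e3.
apply: (@le_lt_trans _ _ (e / 2)); last by rewrite ltrDl.
apply: supnorm_le => x; rewrite cfunBE -(subrKA (v x)) (le_trans (absCD _ _))//.
by rewrite [leRHS]splitr lerD// ltW.
Qed.
End complete.
HB.instance Definition _ (R : realType) (S : dynSystem) :=
  Uniform_isComplete.Build (cfun R S) (@cfun_complete R S).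

Section esum_real.
Variables (R : realType) (I : choiceType) (r : I -> R).
Hypothesis r0 : forall i, 0 <= r i.

Lemma fset_sum_le_esum (A : {fset I}) :
  ((\sum_(i <- A) r i)%:E <= \esum_(i in [set: I]) (r i)%:E)%E.
Proof.
rewrite -sumEFin; apply: ereal_sup_ubound; exists [set` A] => //.
by rewrite fsbig_finite//= set_fsetK.
Qed.

Lemma esum_le_fset (M : R) : (forall A : {fset I}, \sum_(i <- A) r i <= M) ->
  (\esum_(i in [set: I]) (r i)%:E <= M%:E)%E.
Proof.
move=> rM; apply: ge_ereal_sup => _ [A [finA _] <-].
by rewrite fsbig_finite//= sumEFin lee_fin.
Qed.

Lemma esum_tail (e : R) : (\esum_(i in [set: I]) (r i)%:E < +oo)%E -> 0 < e ->
  exists A : {fset I}, forall B : {fset I}, (A `<=` B)%fset ->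
    \sum_(i <- B) r i - \sum_(i <- A) r i < e.
Proof.
move=> rfin e0.
have fn : (\esum_(i in [set: I]) (r i)%:E)%E \is a fin_num.
  by rewrite ge0_fin_numE// esum_ge0// => i _; rewrite lee_fin.
have [_ [A [finA _] <-]] := ub_ereal_sup_adherent e0 fn.
rewrite fsbig_finite//= sumEFin -[ereal_sup _]/(\esum_(i in _) _)%E => hA.
exists (fset_set A) => B AB; have := fset_sum_le_esum B.
move: hA; rewrite -(fineK fn) -EFinB lte_fin lee_fin.
by move=> h1 h2; lra.
Qed.

End esum_real.

Lemma sum_fset_sub (V : zmodType) (I : choiceType) (A B : {fset I}) (x : I -> V) :
  (A `<=` B)%fset ->
  \sum_(i <- B) x i - \sum_(i <- A) x i = \sum_(i <- [fset i in B | i \notin A]%fset) x i.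
Proof.
move=> AB; rewrite (big_fsetID _ (mem A) B)/=.
have -> : [fset i in B | i \in A]%fset = A.
  apply/fsetP => i; rewrite !inE /=; case: (boolP (i \in A)) => iA.
    by rewrite andbT (fsubsetP AB).
  by rewrite andbF.
by rewrite addrAC subrr add0r.
Qed.

Lemma big_fsetM (V : nmodType) (I J : choiceType) (A : {fset I}) (B : {fset J}) (x : I * J -> V) :
  \sum_(p <- (A `*` B)%fset) x p = \sum_(i <- A) \sum_(j <- B) x (i, j).
Proof.
rewrite -(@big_allpairs _ _ _ _ _ (enum_fset A) (enum_fset B) x) /=.
apply: perm_big; apply: uniq_perm; first exact: fset_uniq.
  by apply: allpairs_uniq => // -[a b] [c d].
move=> [i j]; rewrite in_fsetM /=; apply/idP/allpairsP.
  by case/andP => iA jB; exists (i, j).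
by case=> -[a b] /= [aA bB [-> ->]]; rewrite aA bB.
Qed.

Section hsum.
Variables (R : realType) (V : completeNormedModType (Cplx R)).
Local Notation C := (Cplx R).
Local Notation rnorm := (@rnorm R V).

Lemma rnorm_sum (I : Type) (s : seq I) (P : pred I) (x : I -> V) :
  rnorm (\sum_(i <- s | P i) x i) <= \sum_(i <- s | P i) rnorm (x i).
Proof.
elim/big_ind2 : _ => [|u a v b ua vb|//]; first by rewrite rnorm0.
exact: le_trans (rnormD _ _) (lerD ua vb).
Qed.

(* Unordered (net) convergence of the family x to l; see hsumP for the
   relation with `summability.sum`. *)
Definition hsum (I : choiceType) (x : I -> V) (l : V) :=
  forall e : R, 0 < e -> exists A : {fset I}, forall B : {fset I},
    (A `<=` B)%fset -> rnorm (l - \sum_(i <- B) x i) < e.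

Lemma totally_filter (I : choiceType) : ProperFilter (@summability.totally I).
Proof.
apply: filter_from_proper; last by move=> A _; exists A => /=.
apply: filter_fromT_filter; first by exists fset0.
by move=> A B /=; exists (A `|` B)%fset => P /=; rewrite fsubUset => /andP[].
Qed.

#[local] Existing Instance totally_filter.

Lemma partial_sumE (I : choiceType) (x : I -> V) A :
  summability.partial_sum x A = \sum_(i <- A) x i.
Proof. by rewrite /summability.partial_sum big_seq_fsetE. Qed.

Lemma hsumP (I : choiceType) (x : I -> V) (l : V) :
  hsum x l <-> summability.partial_sum x @ (@summability.totally I) --> l.
Proof.
split=> [h|/rnorm_fcvgP h e e0].
  apply/rnorm_fcvgP => e e0; have [A hA] := h _ e0; exists A => // B AB.
  by rewrite /= partial_sumE; exact: hA.
have [A _ hA] := h _ e0; exists A => B AB.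
by rewrite -partial_sumE; exact: hA.
Qed.

Lemma hsum_sum (I : choiceType) (x : I -> V) (l : V) :
  hsum x l -> summability.sum x = l.
Proof. by move=> /hsumP h; apply: norm_cvg_lim. Qed.

Definition asum (I : choiceType) (x : I -> V) : \bar R :=
  (\esum_(i in [set: I]) (rnorm (x i))%:E)%E.

Lemma asum_ge0 (I : choiceType) (x : I -> V) : (0 <= asum x)%E.
Proof. by apply: esum_ge0 => i _; rewrite lee_fin rnorm_ge0. Qed.

Lemma asum_hsum (I : choiceType) (x : I -> V) :
  (asum x < +oo)%E -> hsum x (summability.sum x).
Proof.
move=> xfin; apply/hsumP.
suff : cvg (summability.partial_sum x @ (@summability.totally I)) by [].
apply: cauchy_cvg; apply: cauchy_rnorm => e e0.
have [A hA] := esum_tail (fun i => rnorm_ge0 (x i)) xfin e0.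
exists (\sum_(i <- A) x i); exists A => // B AB /=.
rewrite partial_sumE -rnormN opprB sum_fset_sub//.
apply: le_lt_trans (rnorm_sum _ _ _) _.
by rewrite -sum_fset_sub//; exact: hA.
Qed.

Lemma hsum_le (I : choiceType) (x : I -> V) (l : V) M : hsum x l ->
  (forall A : {fset I}, \sum_(i <- A) rnorm (x i) <= M) -> rnorm l <= M.
Proof.
move=> h xM; apply/ler_addgt0Pr => e e0; have [A /(_ A)] := h _ e0.
move=> /(_ (fsubset_refl _)) lA.
rewrite -(subrK (\sum_(i <- A) x i) l) (le_trans (rnormD _ _))// addrC.
by rewrite lerD ?(ltW lA)// (le_trans (rnorm_sum _ _ _)).
Qed.

Lemma asum_le (I : choiceType) (x : I -> V) : (asum x < +oo)%E ->
  ((rnorm (summability.sum x))%:E <= asum x)%E.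
Proof.
move=> xfin.
have fn : asum x \is a fin_num by rewrite ge0_fin_numE// asum_ge0.
rewrite -(fineK fn) lee_fin; apply: hsum_le (asum_hsum xfin) _ => A.
rewrite -lee_fin fineK//.
exact: fset_sum_le_esum.
Qed.

Lemma hsum_uniq (I : choiceType) (x : I -> V) l m :
  hsum x l -> hsum x m -> l = m.
Proof. by move=> /hsum_sum <- /hsum_sum <-. Qed.

Lemma hsumD (I : choiceType) (x y : I -> V) l m :
  hsum x l -> hsum y m -> hsum (fun i => x i + y i) (l + m).
Proof.
move=> hx hy e e0; have e2 : 0 < e / 2 by rewrite divr_gt0.
have [A hA] := hx _ e2; have [B hB] := hy _ e2.
exists (A `|` B)%fset => D; rewrite fsubUset => /andP[AD BD].
rewrite big_split /= opprD addrACA (le_lt_trans (rnormD _ _))//.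
by rewrite (splitr e) ltrD ?hA ?hB.
Qed.

Lemma hsum_bounded (I : choiceType) (f : V -> V) (M : R) (x : I -> V) l :
  {morph f : u v / u - v} -> (forall v, rnorm (f v) <= M * rnorm v) ->
  hsum x l -> hsum (f \o x) (f l).
Proof.
move=> fB fM hx e e0.
have f0 : f 0 = 0 by have := fB 0 0; rewrite !subrr.
have fN v : f (- v) = - f v by rewrite -(sub0r v) fB f0 sub0r.
have fD u v : f (u + v) = f u + f v by rewrite -{1}(opprK v) fB fN opprK.
have M0 : 0 < `|M| + 1 by rewrite ltr_wpDl.
have [A hA] := hx _ (divr_gt0 e0 M0); exists A => B /hA.
rewrite ltr_pdivlMr// => lt_e.
have -> : \sum_(i <- B) (f \o x) i = f (\sum_(i <- B) x i).
  by rewrite (big_morph f fD f0).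
rewrite -fB; apply: le_lt_trans (fM _) _; apply: le_lt_trans lt_e.
rewrite mulrC ler_wpM2l ?rnorm_ge0//.
by rewrite (le_trans (ler_norm _))// lerDl.
Qed.

Lemma hsum_eq (I : choiceType) (x y : I -> V) l :
  (forall i, x i = y i) -> hsum x l -> hsum y l.
Proof. by move=> /funext ->. Qed.

Lemma hsum_bij (I J : choiceType) (e : I -> J) (g : J -> I) (x : J -> V) l :
  cancel e g -> cancel g e -> hsum x l -> hsum (x \o e) l.
Proof.
move=> eK gK hx d d0; have [A hA] := hx _ d0.
exists (g @` A)%fset => B AB.
have := hA (e @` B)%fset; rewrite big_imfset /=; last first.
  by move=> i j _ _; exact: (can_inj eK).
apply; apply/fsubsetP => j jA; apply/imfsetP; exists (g j) => //=.
by apply: (fsubsetP AB); apply/imfsetP; exists j.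
Qed.

Lemma hsum1 (I : choiceType) (x : I -> V) i0 :
  (forall i, i != i0 -> x i = 0) -> hsum x (x i0).
Proof.
move=> x0 e e0; exists [fset i0]%fset => B; rewrite fsub1set => iB.
rewrite (big_fsetD1 i0)//= big1_fset ?addr0 ?subrr ?rnorm0// => i.
by rewrite !inE => /andP[/x0].
Qed.

Lemma hsum0 (I : choiceType) : hsum (fun i : I => 0) 0.
Proof.
move=> e e0; exists fset0 => B _.
by rewrite big1 ?subr0 ?rnorm0.
Qed.

Lemma hsum_fsum (I J : choiceType) (x : I -> J -> V) (r : I -> V) (s : seq I) :
  (forall i, hsum (x i) (r i)) ->
  hsum (fun j => \sum_(i <- s) x i j) (\sum_(i <- s) r i).
Proof.
move=> h; elim: s => [|i s IH].
  by rewrite big_nil; under [X in hsum X]eq_fun do rewrite big_nil; exact: hsum0.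
rewrite big_cons; under [X in hsum X]eq_fun do rewrite big_cons.
exact: hsumD.
Qed.

Lemma hsum_fubini (I J : choiceType) (x : I * J -> V) (r : I -> V) L :
  hsum x L -> (forall i, hsum (fun j => x (i, j)) (r i)) -> hsum r L.
Proof.
move=> hx hr e e0; have e2 : 0 < e / 2 by rewrite divr_gt0.
have [A hA] := hx _ e2.
exists (fst @` A)%fset => B AB.
have [D hD] := hsum_fsum (enum_fset B) hr e2.
pose E := (D `|` snd @` A)%fset.
have {}hD := hD E (fsubsetUl _ _).
have ABE : (A `<=` B `*` E)%fset.
  apply/fsubsetP => -[i j] ijA; rewrite in_fsetM /=.
  rewrite (fsubsetP AB)/=; last by apply/imfsetP; exists (i, j).
  by rewrite inE; apply/orP; right; apply/imfsetP; exists (i, j).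
have {}hA := hA _ ABE.
rewrite big_fsetM exchange_big /= in hA.
rewrite -(subrKA (\sum_(j <- E) \sum_(i <- B) x (i, j))).
rewrite (le_lt_trans (rnormD _ _))// (splitr e) ltrD//.
by rewrite -rnormN opprB.
Qed.

End hsum.

Lemma esum_prod (R : realType) (I J : choiceType) (x : I -> R) (y : J -> R) :
  (forall i, 0 <= x i) -> (forall j, 0 <= y j) ->
  (\esum_(i in [set: I]) (x i)%:E < +oo)%E ->
  (\esum_(j in [set: J]) (y j)%:E < +oo)%E ->
  (\esum_(p in [set: I * J]) (x p.1 * y p.2)%:E < +oo)%E.
Proof.
move=> x0 y0 xfin yfin.
have fub (K : choiceType) (z : K -> R) : (forall i, 0 <= z i) ->
    (\esum_(i in [set: K]) (z i)%:E < +oo)%E ->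
    exists M, forall A : {fset K}, \sum_(i <- A) z i <= M.
  move=> z0 zfin; exists (fine (\esum_(i in [set: K]) (z i)%:E)) => A.
  rewrite -lee_fin fineK; first exact: fset_sum_le_esum.
  by rewrite ge0_fin_numE// esum_ge0// => i _; rewrite lee_fin.
have [M xM] := fub _ _ x0 xfin; have [N yN] := fub _ _ y0 yfin.
apply: (@le_lt_trans _ _ (M * N)%:E); last by rewrite ltry.
apply: esum_le_fset => A.
pose A1 := (fst @` A)%fset; pose A2 := (snd @` A)%fset.
apply: (@le_trans _ _ (\sum_(p <- (A1 `*` A2)%fset) x p.1 * y p.2)).
  rewrite -subr_ge0 sum_fset_sub; first by apply: sumr_ge0 => p _; exact: mulr_ge0.
  apply/fsubsetP => -[i j] ijA; rewrite in_fsetM /=.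
  by apply/andP; split; apply/imfsetP; exists (i, j).
rewrite (big_fsetM _ _ (fun p => x p.1 * y p.2)) /= -big_distrlr /=.
by apply: ler_pM; rewrite ?xM ?yN ?sumr_ge0.
Qed.

Section families.
Variables (R : realType) (V : completeNormedModType (Cplx R)).
Variables (I J : choiceType) (F : I * J -> V).
Hypothesis Ffin : (asum F < +oo)%E.

Let rowsE :
  (\esum_(i in [set: I]) asum (fun j => F (i, j)) = asum F)%E.
Proof.
rewrite /asum esum_esum; last by move=> i j _ _; rewrite lee_fin rnorm_ge0.
rewrite (_ : [set: I] `*`` (fun=> [set: J]) = setT); last first.
  by apply/seteqP; split.
by apply: eq_esum => -[].
Qed.

Lemma asum_row i : (asum (fun j => F (i, j)) < +oo)%E.
Proof.
apply: le_lt_trans Ffin; rewrite -rowsE; apply: esum_ge.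
by exists [set i] => //; rewrite fsbig_set1.
Qed.

Lemma asum_rowsum : (asum (fun i => summability.sum (fun j => F (i, j))) < +oo)%E.
Proof.
apply: le_lt_trans Ffin; rewrite -rowsE; apply: le_esum => i _.
exact: asum_le (asum_row i).
Qed.

Lemma hsum_rowsum (r : I -> V) : (forall i, hsum (fun j => F (i, j)) (r i)) ->
  hsum r (summability.sum F).
Proof. exact: hsum_fubini (asum_hsum Ffin). Qed.

End families.

Section alpha.
Variables (R : realType) (S : dynSystem).
Local Notation CX := (cfun R S).

Lemma alpha_subproof (k : int) (f : CX) : (f \o zpow (sigma S) (- k)) \in @contf R S.
Proof.
apply/contfP => x; apply: continuous_comp; first exact: zpow_continuous.
exact: cfun_continuous.
Qed.

(* The k-th power of the automorphism f |-> f \o sigma^-1. *)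
Definition alpha (k : int) (f : CX) : CX := CFun (alpha_subproof k f).

Lemma alphaE k f x : alpha k f x = f (zpow (sigma S) (- k) x).
Proof. by []. Qed.

Lemma alpha1E f x : alpha 1 f x = f (hinv (sigma S) x).
Proof. by []. Qed.

Lemma alphaD k l f : alpha (k + l) f = alpha k (alpha l f).
Proof. by apply: cfunP => x; rewrite !alphaE opprD addrC zpowD. Qed.

Lemma alpha_id f : alpha 0 f = f.
Proof. by apply: cfunP. Qed.

Lemma alpha_sub k : {morph alpha k : f g / f - g}.
Proof. by move=> f g; apply: cfunP. Qed.

Lemma alpha_add k : {morph alpha k : f g / f + g}.
Proof. by move=> f g; apply: cfunP. Qed.

Lemma alpha_mul k : {morph alpha k : f g / f * g}.
Proof. by move=> f g; apply: cfunP. Qed.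

Lemma alpha_one k : alpha k 1 = 1.
Proof. exact: cfunP. Qed.

Lemma alpha_zero k : alpha k 0 = 0.
Proof. exact: cfunP. Qed.

Lemma alpha_scale k c f : alpha k (c *: f) = c *: alpha k f.
Proof. exact: cfunP. Qed.

Lemma supnorm_alpha k f : supnorm (alpha k f) <= supnorm f.
Proof. by apply: supnorm_le => x; exact: (le_supnorm f). Qed.

Lemma rnorm_alpha k f : rnorm (alpha k f) <= rnorm f.
Proof. by rewrite -!supnorm_rnorm supnorm_alpha. Qed.

Lemma rnormM (f g : CX) : rnorm (f * g) <= rnorm f * rnorm g.
Proof. by rewrite -!supnorm_rnorm supnormM. Qed.

Lemma rnormZ (c : Cplx R) (f : CX) : rnorm (c *: f) = absC c * rnorm f.
Proof. by rewrite -!supnorm_rnorm supnormZ. Qed.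

End alpha.

Section l1.
Variables (R : realType) (S : dynSystem).
Local Notation C := (Cplx R).
Local Notation CX := (cfun R S).

Definition l1pred : {pred int -> CX} := fun a =>
  (\esum_(n in [set: int]) (supnorm (a n))%:E < +oo)%E.

Lemma l1predP (a : int -> CX) : (a \in l1pred) = (asum a < +oo)%E.
Proof. by []. Qed.

Record l1 := L1 { l1_val :> int -> CX; _ : l1_val \in l1pred }.

HB.instance Definition _ := [isSub for l1_val].
HB.instance Definition _ := [Choice of l1 by <:].

Lemma l1_asum (a : l1) : (asum a < +oo)%E.
Proof. by case: a. Qed.

Lemma l1pred_submod : submod_closed l1pred.
Proof.
split=> [|c a b]; rewrite !l1predP /asum.
  by rewrite esum1 ?ltry// => n _; rewrite rnorm0.
move=> ha hb.
pose M := absC c.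
have hc : (\esum_(n in [set: int]) (absC c * rnorm (a n))%:E < +oo)%E.
  have := @esum_prod R unit int (fun=> absC c) (fun n => rnorm (a n)).
  move=> /(_ (fun=> absC_ge0 _) (fun=> rnorm_ge0 _)).
  move=> /(_ _ ha); rewrite (_ : [set: unit] = [set tt]); last first.
    by apply/seteqP; split=> // -[].
  rewrite esum_set1 ?lee_fin ?absC_ge0// => /(_ (ltry _)).
  rewrite (reindex_esum [set: int] [set: unit * int] (fun n => (tt, n)))//.
  split=> // [m n _ _ [->]//|[[] n] _]; by exists n.
apply: (@le_lt_trans _ _ (\esum_(n in [set: int])
    ((absC c * rnorm (a n))%:E + (rnorm (b n))%:E))%E).
  apply: le_esum => n _; rewrite -EFinD lee_fin -rnormZ.
  exact: rnormD.
rewrite esumD ?lte_add_pinfty// => n _; rewrite lee_fin ?rnorm_ge0//.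
by rewrite mulr_ge0 ?absC_ge0 ?rnorm_ge0.
Qed.

HB.instance Definition _ :=
  GRing.SubChoice_isSubLmodule.Build C (int -> CX) l1pred l1 l1pred_submod.

Lemma l1P (a b : l1) : (forall n, a n = b n) -> a = b.
Proof. by move=> ab; apply/val_inj/funext. Qed.

(* The series is an unordered sum for the norm of C(X); it converges by
   conv_hsum. *)
Definition conv (a b : int -> CX) (n : int) : CX :=
  summability.sum (fun k : int => a k * alpha k (b (n - k))).

Let shear (p : int * int) : int * int := (p.1 + p.2, p.1).
Let shearV (p : int * int) : int * int := (p.2, p.1 - p.2).
Let shearK : cancel shear shearV.
Proof. by case=> i j; rewrite /shear/shearV /= addrAC subrr add0r. Qed.
Let shearVK : cancel shearV shear.
Proof. by case=> i j; rewrite /shear/shearV /= addrC subrK. Qed.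

Lemma conv_asum (a b : l1) :
  (asum (fun p : int * int => a p.2 * alpha p.2 (b (p.1 - p.2)))%R < +oo)%E.
Proof.
have := esum_prod (fun n => rnorm_ge0 (a n)) (fun n => rnorm_ge0 (b n))
  (l1_asum a) (l1_asum b).
apply: le_lt_trans; rewrite /asum.
rewrite (reindex_esum [set: int * int] [set: int * int] shear); last first.
  by rewrite setTT_bijective; exists shearV.
apply: le_esum => -[i j] _; rewrite /= addrAC subrr add0r lee_fin.
by rewrite (le_trans (rnormM _ _))// ler_wpM2l ?rnorm_ge0 ?rnorm_alpha.
Qed.

Lemma conv_hsum (a b : l1) n :
  hsum (fun k : int => a k * alpha k (b (n - k))) (conv a b n).
Proof. exact: asum_hsum (asum_row (conv_asum a b) n). Qed.

Lemma conv_l1 (a b : l1) : conv a b \in l1pred.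
Proof. by rewrite l1predP; exact: asum_rowsum (conv_asum a b). Qed.

Definition l1mul (a b : l1) : l1 := L1 (conv_l1 a b).

Definition l1one_fun (n : int) : CX := if n == 0 then 1 else 0.

Lemma l1one_subproof : l1one_fun \in l1pred.
Proof.
rewrite l1predP; apply: (@le_lt_trans _ _ (rnorm (1 : CX))%:E); last exact: ltry.
apply: esum_le_fset => A.
have -> : \sum_(n <- A) rnorm (l1one_fun n) =
    \sum_(n <- A) (if n == 0 then rnorm (1 : CX) else 0).
  by apply: eq_bigr => n _; rewrite /l1one_fun; case: ifP => // _; rewrite rnorm0.
rewrite -big_mkcond /= big_fset_condE /=.
have [A0|A0] := boolP ((0 : int) \in A).
  rewrite (_ : [fset n in A | n == 0]%fset = [fset 0]%fset) ?big_seq_fset1//.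
  by apply/fsetP => n; rewrite !inE /=; apply/andP/eqP => [[_ /eqP]|->].
rewrite (_ : [fset n in A | n == 0]%fset = fset0) ?big_seq_fset0 ?rnorm_ge0//.
apply/fsetP => n; rewrite !inE /=; apply/negP => /andP[nA /eqP n0].
by rewrite n0 (negPf A0) in nA.
Qed.

Definition l1one : l1 := L1 l1one_subproof.

Lemma l1mulA : associative l1mul.
Proof.
move=> a b c; apply: l1P => n /=.
pose G (p : int * int) :=
  a p.2 * alpha p.2 (b (p.1 - p.2)) * alpha p.1 (c (n - p.1)).
have Gfin : (asum G < +oo)%E.
  have [M cM] : exists M, forall m, rnorm (c m) <= M.
    have fn : asum c \is a fin_num by rewrite ge0_fin_numE ?asum_ge0// l1_asum.
    exists (fine (asum c)) => m; rewrite -lee_fin fineK//.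
    have := fset_sum_le_esum (fun i => rnorm (c i)) [fset m]%fset.
    by rewrite big_seq_fset1.
  have := esum_prod (x := fun=> M) (y := fun p : int * int =>
    rnorm (a p.2 * alpha p.2 (b (p.1 - p.2)))) (I := unit).
  have M0 : 0 <= M by apply: le_trans (cM 0); exact: rnorm_ge0.
  move=> /(_ (fun=> M0) (fun=> rnorm_ge0 _)).
  rewrite (_ : [set: unit] = [set tt]); last by apply/seteqP; split=> // -[].
  rewrite esum_set1 ?lee_fin// => /(_ (ltry _) (conv_asum a b)).
  rewrite (reindex_esum [set: int * int] _ (fun p => (tt, p))); last first.
    by split=> // [m m' _ _ [->]//|[[] m] _]; exists m.
  apply: le_lt_trans; apply: le_esum => -[k j] _; rewrite lee_fin /=.
  rewrite mulrC (le_trans (rnormM _ _))// ler_wpM2l ?rnorm_ge0//.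
  exact: le_trans (rnorm_alpha _ _) (cM _).
have GL := asum_hsum Gfin; set L := summability.sum G in GL.
transitivity L.
  have GL' := hsum_bij shearK shearVK GL.
  apply: hsum_sum; apply: hsum_fubini GL' _ => j.
  apply: hsum_eq (hsum_bounded (M := rnorm (a j))
    (f := fun f => a j * alpha j f) _ _ (conv_hsum b c (n - j))) => [m|f g|f] /=.
  - have jm : j + m - j = m by rewrite addrAC subrr add0r.
    by rewrite /G /= jm alpha_mul mulrA alphaD opprD addrA.
  - by rewrite [X in _ * X](alpha_sub j f g) mulrBr.
  - by rewrite (le_trans (rnormM _ _))// ler_wpM2l ?rnorm_ge0 ?rnorm_alpha.
apply/esym/hsum_sum; apply: hsum_fubini GL _ => k.
pose f (g : CX) : CX := g * alpha k (c (n - k)).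
have fB : {morph f : g h / g - h} by move=> g h; rewrite /f mulrBl.
have fM g : rnorm (f g) <= rnorm (c (n - k)) * rnorm g.
  rewrite mulrC (le_trans (rnormM _ _))// ler_wpM2l ?rnorm_ge0//.
  exact: rnorm_alpha.
exact: hsum_bounded fB fM (conv_hsum a b k).
Qed.

Lemma l1mul1r : left_id l1one l1mul.
Proof.
move=> a; apply: l1P => n /=; apply: hsum_sum.
have := @hsum1 _ _ _ (fun k : int => l1one_fun k * alpha k (a (n - k))) 0.
rewrite {3}/l1one_fun eqxx mul1r alpha_id subr0; apply=> k /negPf k0.
by rewrite /l1one_fun k0 mul0r.
Qed.

Lemma l1mulr1 : right_id l1one l1mul.
Proof.
move=> a; apply: l1P => n /=; apply: hsum_sum.
have := @hsum1 _ _ _ (fun k : int => a k * alpha k (l1one_fun (n - k))) n.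
rewrite {3}/l1one_fun subrr eqxx alpha_one mulr1; apply=> k.
by rewrite /l1one_fun subr_eq0 eq_sym => /negPf ->; rewrite alpha_zero mulr0.
Qed.

Lemma l1mulDl : left_distributive l1mul +%R.
Proof.
move=> a b c; apply: l1P => n; apply: hsum_sum.
apply: hsum_eq (hsumD (conv_hsum a c n) (conv_hsum b c n)) => k.
by rewrite -mulrDl.
Qed.

Lemma l1mulDr : right_distributive l1mul +%R.
Proof.
move=> a b c; apply: l1P => n; apply: hsum_sum.
apply: hsum_eq (hsumD (conv_hsum a b n) (conv_hsum a c n)) => k.
by rewrite -mulrDr -alpha_add.
Qed.

Lemma l1one_neq0 : l1one != 0.
Proof.
apply/eqP => /(congr1 (fun a : l1 => a 0 : CX)) /= h.
case: (space_nonempty S) => x _.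
have : (l1one_fun 0) x = (0 : CX) x by rewrite h.
by rewrite /l1one_fun eqxx cfun1E cfun0E => /eqP; rewrite oner_eq0.
Qed.

HB.instance Definition _ := GRing.Zmodule_isNzRing.Build l1
  l1mulA l1mul1r l1mulr1 l1mulDl l1mulDr l1one_neq0.

Lemma l1_scaleAl (c : C) (a b : l1) : c *: (a * b) = (c *: a) * b.
Proof.
apply: l1P => n; apply/esym/hsum_sum.
apply: hsum_eq (hsum_bounded (M := absC c) (f := fun f => c *: f)
   _ _ (conv_hsum a b n)) => [k|f g|f] /=.
- by apply: cfunP => x; rewrite cfunZE !cfunME mulrA.
- by rewrite scalerBr.
- by rewrite rnormZ.
Qed.

Lemma l1_scaleAr (c : C) (a b : l1) : c *: (a * b) = a * (c *: b).
Proof.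
apply: l1P => n; apply/esym/hsum_sum.
apply: hsum_eq (hsum_bounded (M := absC c) (f := fun f => c *: f)
   _ _ (conv_hsum a b n)) => [k|f g|f] /=.
- by apply: cfunP => x; rewrite !cfunZE !cfunME !alphaE cfunZE mulrCA.
- by rewrite scalerBr.
- by rewrite rnormZ.
Qed.

HB.instance Definition _ := GRing.Lmodule_isLalgebra.Build C l1 l1_scaleAl.
HB.instance Definition _ := GRing.Lalgebra_isAlgebra.Build C l1 l1_scaleAr.

Lemma l1mulE (a b : l1) n :
  (a * b) n = summability.sum (fun k : int => a k * alpha k (b (n - k))).
Proof. by []. Qed.

Lemma l1mul_cvg (a b : l1) n :
  summability.partial_sum (fun k : int => a k * alpha k (b (n - k)))
    @ (@summability.totally int) --> (a * b) n.
Proof. by apply/hsumP; exact: conv_hsum. Qed.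

End l1.

Section representations.
Variables (K : fieldType) (A : algType K).

(* An algebra morphism from A to End(E); it is not required to be unital. *)
Record representation (E : lmodType K) := Representation {
  rep :> A -> E -> E;
  rep_linearl : forall e : E, linear (rep^~ e);
  rep_linearr : forall a : A, linear (rep a);
  rep_mul : forall (a b : A) (e : E), rep (a * b) e = rep a (rep b e) }.

Definition subspace_of (E : lmodType K) (W : set E) : Prop :=
  W 0 /\ forall (c : K) (u v : E), W u -> W v -> W (c *: u + v).

Definition alg_irreducible (E : lmodType K) (pi : representation E) : Prop :=
  (exists (a : A) (e : E), pi a e != 0) /\
  forall W : set E, subspace_of W -> (forall a e, W e -> W (pi a e)) ->
    W = [set 0] \/ W = setT.

Definition rep_ker (E : lmodType K) (pi : representation E) : set A :=
  [set a | forall e, pi a e = 0].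

Definition primitive_ideal (P : set A) : Prop :=
  exists (E : lmodType K) (pi : representation E),
    alg_irreducible pi /\ P = rep_ker pi.

Lemma rep0l (E : lmodType K) (pi : representation E) e : pi 0 e = 0.
Proof.
have := @rep_linearl _ pi e (-1) 0 0.
by rewrite scaler0 addr0 scaleN1r addrC subrr.
Qed.

Lemma rep0r (E : lmodType K) (pi : representation E) a : pi a 0 = 0.
Proof.
have := @rep_linearr _ pi a (-1) 0 0.
by rewrite scaler0 addr0 scaleN1r addrC subrr.
Qed.

Lemma primitive_prime (P : set A) (a b : A) : primitive_ideal P ->
  (forall c, P (a * c * b)) -> P a \/ P b.
Proof.
move=> [E [pi [[[a0 [e0 /eqP ne]] irr] ->]]] h.
have r0 := rep0r pi; have l0 := rep0l pi.
have [[v bv]|nb] := pselect (exists v, pi b v <> 0); last first.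
  by right=> v; apply: contrapT => bv; apply: nb; exists v.
left=> e.
pose w := pi b v.
pose N : set E := [set u | forall c, pi c u = 0].
have [] := irr N.
- split=> [c|c u u' Nu Nu' d]; first exact: r0.
  by rewrite rep_linearr Nu Nu' scaler0 addr0.
- by move=> c u Nu d; rewrite Nu r0.
- move=> N0.
  have [] := irr (range (pi^~ w)).
  + split=> [|c _ _ [d _ <-] [d' _ <-]]; first by exists 0; rewrite ?l0.
    by exists (c *: d + d'); rewrite ?rep_linearl.
  + by move=> c _ [d _ <-]; exists (c * d); rewrite ?rep_mul.
  + move=> W0; exfalso; apply: bv; rewrite -/w.
    suff : N w by rewrite N0.
    by move=> c; have : range (pi^~ w) (pi c w) by []; rewrite W0.
  + move=> WT; have : range (pi^~ w) e by rewrite WT.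
    by case=> c _ <-; rewrite /w -!rep_mul h.
- by move=> NT; exfalso; apply: ne; have : N e0 by rewrite NT.
Qed.

End representations.

Section structure_space.
Variables (K : fieldType) (A : algType K).

Definition structure_space := set_type (@primitive_ideal K A).
HB.instance Definition _ := gen_eqMixin structure_space.
HB.instance Definition _ := gen_choiceMixin structure_space.

Definition hk_closure (E : set structure_space) : set structure_space :=
  [set P | \bigcap_(Q in E) val Q `<=` val P].

(* U is open when its complement is closed under the hull-kernel closure. *)
Definition hk_open (U : set structure_space) : Prop :=
  hk_closure (~` U) `<=` ~` U.

Lemma sub_hk_closure E : E `<=` hk_closure E.
Proof. by move=> P EP a; apply. Qed.

Lemma hk_closureS E F : E `<=` F -> hk_closure E `<=` hk_closure F.
Proof. by move=> EF P EP a Fa; apply: EP => Q /EF; apply: Fa. Qed.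

Lemma hk_closure_id E : hk_closure (hk_closure E) `<=` hk_closure E.
Proof. by move=> P EP a Ea; apply: EP => Q; apply; exact: Ea. Qed.

Lemma primitive_mull (P : structure_space) a b : val P b -> val P (a * b).
Proof.
have [E [pi [_ ->]]] := set_valP P => bP e.
by rewrite rep_mul bP rep0r.
Qed.

Lemma primitive_mulr (P : structure_space) a b : val P a -> val P (a * b).
Proof. by have [E [pi [_ ->]]] := set_valP P => aP e; rewrite rep_mul aP. Qed.

Lemma hk_closureU E F : hk_closure (E `|` F) `<=` hk_closure E `|` hk_closure F.
Proof.
move=> P EFP; apply: contrapT => /not_orP[/existsNP[a /not_implyP[Ea Pa]]].
move=> /existsNP[b /not_implyP[Fb Pb]].
have [c|//|//] := primitive_prime (a := a) (b := b) (set_valP P).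
apply: EFP => Q [EQ|FQ]; first by rewrite -mulrA; exact/primitive_mulr/Ea.
exact/primitive_mull/Fb.
Qed.

Lemma hk_openT : hk_open setT.
Proof.
move=> P; rewrite setCT => P0.
have [E [pi [[[a [e /eqP ne]] _] Pk]]] := set_valP P.
apply: ne; suff : val P a by rewrite Pk.
by apply: P0 => Q.
Qed.

Lemma hk_openI : setI_closed hk_open.
Proof.
move=> U V oU oV P; rewrite setCI => /hk_closureU[/oU|/oV] ?; first by left.
by right.
Qed.

Lemma hk_open_bigU (I : Type) (f : I -> set structure_space) :
  (forall i, hk_open (f i)) -> hk_open (\bigcup_i f i).
Proof.
move=> of_ P fP [i _ fiP]; apply: (of_ i P) fiP.
by apply: hk_closureS fP => Q nQ fQ; apply: nQ; exists i.
Qed.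

HB.instance Definition _ :=
  isOpenTopological.Build structure_space hk_openT hk_openI hk_open_bigU.

Lemma closure_structure_space (E : set structure_space) :
  closure E = hk_closure E.
Proof.
apply/seteqP; split; last first.
  move=> P PE U; rewrite nbhsE => -[V [oV VP] VU].
  apply: contrapT => /set0P/negP; rewrite negbK => /eqP EU0.
  have : (~` V) P; last by apply.
  apply: oV; apply: hk_closureS PE => Q EQ VQ.
  suff : (E `&` U) Q by rewrite EU0.
  by split=> //; exact: (VU Q VQ).
have cE : closed (hk_closure E).
  by rewrite -openC; apply: (_ : hk_open _); rewrite /hk_open setCK; exact: hk_closure_id.
by move/closure_id : cE => ->; apply: closure_subset; exact: sub_hk_closure.
Qed.

End structure_space.

(* Main.v *)
(* For a point [x] of period [p], with indicator [e_x], the corner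
   [e_x A e_x] of [A = l1(Sigma)] is the Wiener algebra of the circle, and the
   functionals [ev x la : a |-> \sum_j a (j p) x la^j] satisfy
   [ev (c e_x d) = ev c * ev d].  Hence [ev x la] generates an irreducible
   submodule of the dual of [A], whose kernel is the ideal of the [a] with
   [ev x la (b a c) = 0] for all [b] and [c].

   Conversely, let [pi] be irreducible.  Some [pi e_x] is nonzero, and the
   central element [z = e_O delta^p], where [O] is the orbit of [x], acts by
   a scalar [la].  This is a Gelfand-Mazur argument: otherwise [z - mu] has
   inverses on a cyclic vector that are bounded uniformly for [mu] near the
   circle, while averages of resolvents over roots of unity on circles of radii
   [1 + h] and [1 - h] stay close to each other although they tend to different
   limits, as [z] and its inverse are power bounded.  Since kernels of
   irreducible representations are closed, [pi (e_x a e_x) = ev x la a pi e_x],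
   so the kernel of [pi] is the ideal of [ev x la].

   The resulting bijection from the sum of circles is continuous and its source
   is compact, so it remains to see that the structure space is Hausdorff.
   Points on one circle are separated by the positive and negative parts of a
   trigonometric polynomial [t = Re (z / om)]; they lie in the algebra because
   [|t| = sqrt (1 - (1 - t^2))] and the power series of the square root converges
   absolutely on the unit ball. *)
Require Import Defs.
From HB Require Import structures.
From mathcomp Require Import all_boot all_order all_algebra finmap.
From mathcomp Require Import all_classical all_reals all_analysis.
From mathcomp Require Import complex ring lra.
From mathcomp Require summability.

Set Implicit Arguments.
Unset Strict Implicit.
Unset Printing Implicit Defensive.

Import Order.TTheory GRing.Theory Num.Theory numFieldNormedType.Exports.

Local Open Scope classical_set_scope.
Local Open Scope ring_scope.
Local Open Scope complex_scope.

(** * The norm of l1(Sigma) *)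

Section l1norm.
Variables (R : realType) (S : dynSystem).
Local Notation C := (Cplx R).
Local Notation CX := (cfun R S).
Local Notation A := (l1 R S).

Definition l1norm (a : A) : R := fine (asum a).

Lemma l1normE (a : A) : (l1norm a)%:E = asum a.
Proof. by rewrite fineK// ge0_fin_numE ?asum_ge0// l1_asum. Qed.

Lemma l1norm_le (a : A) M :
  (forall B : {fset int}, \sum_(n <- B) rnorm (a n) <= M) -> l1norm a <= M.
Proof.
by move=> aM; rewrite -lee_fin l1normE; exact: (esum_le_fset aM).
Qed.

Lemma sum_le_l1norm (a : A) (B : {fset int}) :
  \sum_(n <- B) rnorm (a n) <= l1norm a.
Proof.
by rewrite -lee_fin l1normE /asum; apply: fset_sum_le_esum.
Qed.

Lemma coef_le_l1norm (a : A) n : rnorm (a n) <= l1norm a.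
Proof. by have := sum_le_l1norm a [fset n]%fset; rewrite big_seq_fset1. Qed.

Lemma l1norm_ge0 a : 0 <= l1norm a.
Proof. exact: le_trans (rnorm_ge0 _) (coef_le_l1norm a 0). Qed.

Lemma l1normD a b : l1norm (a + b) <= l1norm a + l1norm b.
Proof.
apply: l1norm_le => B.
apply: le_trans (lerD (sum_le_l1norm a B) (sum_le_l1norm b B)).
by rewrite -big_split /=; apply: ler_sum => n _; exact: rnormD.
Qed.

Lemma l1normZ_le (c : C) a : l1norm (c *: a) <= absC c * l1norm a.
Proof.
apply: l1norm_le => B.
apply: le_trans (ler_wpM2l (absC_ge0 c) (sum_le_l1norm a B)).
by rewrite mulr_sumr; apply: ler_sum => n _; rewrite -rnormZ.
Qed.

(** The shear [(i, j) |-> (i + j, i)] turns the double series of the convolution into the family of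
    products, and a finite set of pairs lies in a rectangle. *)
Lemma l1normM a b : l1norm (a * b) <= l1norm a * l1norm b.
Proof.
pose F (p : int * int) := a p.2 * alpha p.2 (b (p.1 - p.2)).
rewrite -lee_fin l1normE.
apply: (@le_trans _ _ (\esum_(n in [set: int]) asum (fun k => F (n, k)))%E).
  by apply: le_esum => n _; exact: asum_le (asum_row (conv_asum a b) n).
rewrite /asum esum_esum; last by move=> i j _ _; rewrite lee_fin rnorm_ge0.
rewrite (_ : [set: int] `*`` (fun=> [set: int]) = setT); last first.
  by apply/seteqP; split.
rewrite (reindex_esum [set: int * int] _ (fun p => (p.1 + p.2, p.1))); last first.
  rewrite setTT_bijective; exists (fun p => (p.2, p.1 - p.2)) => -[i j] /=.
    by rewrite addrAC subrr add0r.
  by rewrite addrC subrK.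
apply: (@le_trans _ _
  (\esum_(p in [set: int * int]) (rnorm (a p.1) * rnorm (b p.2))%:E)%E).
  apply: le_esum => -[i j] _; rewrite /F /= addrAC subrr add0r lee_fin.
  by rewrite (le_trans (rnormM _ _))// ler_wpM2l ?rnorm_ge0 ?rnorm_alpha.
apply: esum_le_fset => B.
pose B1 := (fst @` B)%fset; pose B2 := (snd @` B)%fset.
apply: (@le_trans _ _ (\sum_(p <- (B1 `*` B2)%fset) rnorm (a p.1) * rnorm (b p.2))).
  rewrite -subr_ge0 sum_fset_sub.
    by apply: sumr_ge0 => p _; rewrite mulr_ge0 ?rnorm_ge0.
  apply/fsubsetP => -[i j] ijB; rewrite in_fsetM /=.
  by apply/andP; split; apply/imfsetP; exists (i, j).
rewrite (big_fsetM _ _ (fun p => rnorm (a p.1) * rnorm (b p.2))) /= -big_distrlr /=.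
by apply: ler_pM; rewrite ?sum_le_l1norm// sumr_ge0// => n _; rewrite rnorm_ge0.
Qed.

(** The limit is taken coefficientwise in C(X). Bounds on finite sums of coefficients then give both
    membership in [l1] and the norm estimate. *)
Lemma l1_complete (u : nat -> A) (r : nat -> R) (b : R) :
  (forall n, l1norm (u n.+1 - u n) <= r n.+1 - r n) -> (forall n, r n <= b) ->
  exists l, forall n, l1norm (l - u n) <= b - r n.
Proof.
move=> ur rb.
have r_nd : nondecreasing_seq r.
  apply/nondecreasing_seqP => n; rewrite -subr_ge0.
  exact: le_trans (l1norm_ge0 _) (ur n).
have r_cvg : cvgn r.
  by apply: nondecreasing_is_cvgn => //; exists b => _ [n _ <-].
pose rho := limn r.
have r_le n : r n <= rho by exact: nondecreasing_cvgn_le.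
have r_near (e : R) : 0 < e -> \forall n \near \oo, rho - r n < e.
  move=> e0; have /cvgrPdist_lt/(_ e e0) := r_cvg; apply: filterS => n.
  by apply: le_lt_trans; exact: ler_norm.
have umn m n : (n <= m)%N -> l1norm (u m - u n) <= r m - r n.
  elim: m => [|m IH].
    rewrite leqn0 => /eqP ->; rewrite !subrr.
    by apply: l1norm_le => B; rewrite big1// => k _; exact: rnorm0.
  rewrite leq_eqVlt => /orP[/eqP ->|].
    by rewrite !subrr; apply: l1norm_le => B; rewrite big1// => k _; exact: rnorm0.
  rewrite ltnS => /IH nm; rewrite -(subrKA (u m)) (le_trans (l1normD _ _))//.
  by rewrite -(subrKA (r m) (r m.+1)) lerD.
have /choice[l ul] : forall k, exists lk : CX, forall n,
    rnorm (lk - u n k) <= rho - r n.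
  move=> k.
  have : cauchy ((u n k @[n --> \oo]) : set_system CX).
    apply: cauchy_rnorm => e e0; have [N _ rN] := r_near _ e0.
    exists (u N k); exists N => // n /= Nn; rewrite -rnormN opprB.
    apply: le_lt_trans (rN N (leqnn _)).
    apply: le_trans (coef_le_l1norm (u n - u N) k) _.
    by apply: le_trans (umn _ _ Nn) _; rewrite lerD2r.
  move=> /cauchy_cvg/cvg_ex[lk /rnorm_fcvgP ulk]; exists lk => n.
  apply/ler_addgt0Pr => e e0; have [N _ uN] := ulk e e0.
  rewrite -(subrKA (u (maxn n N) k)) (le_trans (rnormD _ _))// addrC lerD//.
    apply: le_trans (coef_le_l1norm (u (maxn n N) - u n) k) _.
    by apply: le_trans (umn _ _ (leq_maxl _ _)) _; rewrite lerD2r.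
  by apply/ltW/uN; exact: leq_maxr.
have sum_ul n (B : {fset int}) : \sum_(k <- B) rnorm (l k - u n k) <= b - r n.
  apply/ler_addgt0Pr => e e0.
  (* Dividing [e] by [size B + 1] keeps the total error over [B] within [e], also when [B] is
     empty. *)
  have B0 : 0 < (size B).+1%:R :> R by [].
  have [N _ rN] := r_near _ (divr_gt0 e0 B0).
  set m := maxn n N.
  apply: (@le_trans _ _
    (\sum_(k <- B) ((rho - r m) + rnorm ((u m - u n) k)))).
    apply: ler_sum => k _; rewrite -(subrKA (u m k)) (le_trans (rnormD _ _))//.
    by rewrite lerD2r.
  rewrite big_split /= addrC lerD//.
    apply: le_trans (sum_le_l1norm (u m - u n) B) _.
    by apply: le_trans (umn _ _ (leq_maxl _ _)) _; rewrite lerD2r.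
  rewrite big_const_seq count_predT iter_addr_0.
  have /ltW := rN m (leq_maxr _ _).
  rewrite ler_pdivlMr// mulr_natr; apply: le_trans.
  by rewrite ler_wpMn2l// subr_ge0.
have l_l1 : l \in @l1pred R S.
  rewrite l1predP; apply: (@le_lt_trans _ _ (l1norm (u 0) + (b - r 0))%:E).
    apply: esum_le_fset => B.
    apply: le_trans (lerD (sum_le_l1norm (u 0%N) B) (sum_ul 0%N B)).
    rewrite -big_split /=; apply: ler_sum => k _.
    by rewrite -{1}(subrK (u 0%N k) (l k)) addrC rnormD.
  exact: ltry.
by exists (L1 l_l1) => n; apply: l1norm_le => B; exact: sum_ul.
Qed.

End l1norm.

(** * Banach algebras *)

Record banach_norm (R : realType) (A : algType (Cplx R)) (N : A -> R) : Prop := {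
  bn_eq0 : forall a, N a <= 0 -> a = 0;
  bnD : forall a b, N (a + b) <= N a + N b;
  bnZ : forall (c : Cplx R) a, N (c *: a) <= absC c * N a;
  bnM : forall a b, N (a * b) <= N a * N b;
  bn1 : N 1 <= 1;
  (* completeness, for sequences whose increments are dominated by those of a
     bounded real sequence *)
  bn_complete : forall (u : nat -> A) (r : nat -> R) (b : R),
    (forall n, N (u n.+1 - u n) <= r n.+1 - r n) -> (forall n, r n <= b) ->
    exists l, forall n, N (l - u n) <= b - r n }.

Section absC.
Variable R : realType.
Local Notation C := (Cplx R).

Lemma absC_real (r : R) : absC (r%:C : C) = `|r|.
Proof. by rewrite /absC normc_def /= expr0n addr0 sqrtr_sqr. Qed.

Lemma absCN (z : C) : absC (- z) = absC z.
Proof. by rewrite /absC normrN. Qed.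

Lemma absC0 : absC (0 : C) = 0.
Proof. by rewrite /absC normr0. Qed.

Lemma absC1 : absC (1 : C) = 1.
Proof. by rewrite /absC normr1. Qed.

Lemma absC1_neq0 (z : C) : absC z = 1 -> z != 0.
Proof.
by move=> z1; apply: contra_eq_neq z1 => ->; rewrite absC0 eq_sym oner_neq0.
Qed.

Lemma absC_half : absC (2^-1 : C) = 1 / 2.
Proof.
have -> : 2^-1 = (2^-1 : R)%:C :> C by rewrite fmorphV /= rmorph_nat.
by rewrite absC_real ger0_norm ?div1r.
Qed.

Lemma absCX (z : C) n : absC (z ^+ n) = absC z ^+ n.
Proof. by elim: n => [|n IH]; rewrite ?absC1// !exprS absCM IH. Qed.

Lemma absCV (z : C) : absC z^-1 = (absC z)^-1.
Proof.
have [->|z0] := eqVneq z 0; first by rewrite invr0 absC0 invr0.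
have az : absC z != 0 by apply: contra_neq z0; exact: absC_eq0.
by apply: (mulfI az); rewrite -absCM !mulfV// absC1.
Qed.

Lemma circleP (z : C) : circle R z <-> absC z = 1.
Proof.
rewrite /circle /=; split=> [z1|z1]; first by apply: complexI; rewrite absCE z1.
by rewrite -absCE z1.
Qed.

End absC.

Section banach.
Variables (R : realType) (A : algType (Cplx R)) (N : A -> R).
Hypothesis Nb : banach_norm N.
Local Notation C := (Cplx R).

Lemma bn0 : N 0 = 0.
Proof.
have N0 : N 0 <= 0.
  by have := bnZ Nb 0 0; rewrite scale0r absC0 mul0r.
apply/eqP; rewrite eq_le N0 /=.
by have := bnD Nb 0 0; rewrite addr0 -subr_ge0 addrK.
Qed.

Lemma bnN a : N (- a) = N a.
Proof.
have le_ b : N (- b) <= N b.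
  by have := bnZ Nb (-1) b; rewrite scaleN1r absCN absC1 mul1r.
by apply/eqP; rewrite eq_le le_ -{1}(opprK a) le_.
Qed.

Lemma bnB a b : N (a - b) <= N a + N b.
Proof. by rewrite -(bnN b) (bnD Nb). Qed.

Lemma bn_ge0 a : 0 <= N a.
Proof. by have := bnB a a; rewrite subrr bn0 -mulr2n pmulrn_lge0. Qed.

Lemma bnX a n : N (a ^+ n) <= N a ^+ n.
Proof.
elim: n => [|n IH]; first by rewrite !expr0 (bn1 Nb).
by rewrite !exprS (le_trans (bnM Nb _ _))// ler_wpM2l ?bn_ge0.
Qed.

Lemma bn_small_eq0 a (M : R) :
  (forall n, N a <= M / n.+1%:R) -> a = 0.
Proof.
move=> aM; apply: (bn_eq0 Nb); rewrite leNgt; apply/negP => a0.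
pose n := Num.truncn (M / N a); have := aM n.
rewrite ler_pdivlMr// leNgt => /negP; apply.
have [M0|M0] := ltP M 0; first by rewrite (lt_le_trans M0)// mulr_ge0 ?bn_ge0.
by rewrite -ltr_pdivrMl// mulrC truncnS_gt.
Qed.

(** Method of majorants: the increments of the iterates of [F] from 0 are dominated by those of the
    real iterates of [f], which increase to the fixed point [b]. The rate [K / n.+1] replaces a
    limit argument, and commutation passes from the iterates to the limit. *)
Lemma majorized_fixpoint (F : A -> A) (f : R -> R) (b K : R) :
  f b = b -> 0 <= b -> 0 <= f 0 -> N (F 0) <= f 0 ->
  (forall r s, 0 <= s -> s <= r -> r <= b -> f s <= f r) ->
  (forall x y r s, 0 <= s -> s <= r -> r <= b -> N x <= r -> N y <= s ->
    N (x - y) <= r - s -> N (F x - F y) <= f r - f s) ->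
  (forall n, b - iter n f 0 <= K / n.+1%:R) ->
  exists l, [/\ F l = l, N l <= b & forall c,
    (forall x, c * x = x * c -> c * F x = F x * c) -> c * l = l * c].
Proof.
move=> fb b0 f0 F0 fmono FL fK.
pose r n := iter n f 0; pose u n := iter n F 0.
have rb n : 0 <= r n <= b.
  elim: n => [|n /andP[r0 rb]]; first by rewrite lexx.
  by rewrite (le_trans f0) ?fmono//= -[leRHS]fb fmono.
have rS n : r n <= r n.+1.
  elim: n => [//|n IH]; apply: fmono => //; first by case/andP: (rb n).
  by case/andP: (rb n.+1).
have ur n : N (u n.+1 - u n) <= r n.+1 - r n /\ N (u n) <= r n.
  elim: n => [|n [IH Nu]]; first by rewrite /= bn0 !subr0.
  have uS : N (u n.+1) <= r n.+1.
    by rewrite -(subrK (u n) (u n.+1)) (le_trans (bnD Nb _ _))// -lerBrDr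
      (le_trans IH)// lerD2l lerN2.
  split=> //; apply: FL => //; first by case/andP: (rb n).
  by case/andP: (rb n.+1).
have [||l ul] := bn_complete Nb (u := u) (r := r) (b := b).
- by move=> n; case: (ur n).
- by move=> n; case/andP: (rb n).
have Nl : N l <= b by have := ul 0%N; rewrite /= !subr0.
exists l; split=> // [|c cF].
- apply/eqP; rewrite -subr_eq0; apply/eqP.
  apply: (bn_small_eq0 (M := K + K)) => n.
  rewrite mulrDl -(subrKA (u n.+1) (F l)) (le_trans (bnD Nb _ _))// lerD//.
    have /andP[r0 r1] := rb n.
    apply: le_trans (fK n); apply: (@le_trans _ _ (f b - f (r n))).
      by apply: FL => //; case: (ur n).
    by rewrite fb lerD2l lerN2; exact: (rS n).
  rewrite -bnN opprB (le_trans (ul _))// (le_trans _ (fK n))//.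
  by rewrite lerD2l lerN2; exact: (rS n).
- have cu n : c * u n = u n * c.
    by elim: n => [|n IH]; rewrite ?mulr0 ?mul0r//=; exact: cF.
  apply/eqP; rewrite -subr_eq0; apply/eqP.
  apply: (bn_small_eq0 (M := N c * K + N c * K)) => n.
  have -> : c * l - l * c = c * (l - u n) - (l - u n) * c.
    by rewrite mulrBr mulrBl cu opprB addrA subrK.
  rewrite [leRHS]mulrDl (le_trans (bnB _ _))// lerD//.
    rewrite (le_trans (bnM Nb _ _))// -mulrA ler_wpM2l ?bn_ge0//.
    exact: le_trans (ul n) (fK n).
  rewrite (le_trans (bnM Nb _ _))// mulrC -mulrA ler_wpM2l ?bn_ge0//.
  exact: le_trans (ul n) (fK n).
Qed.

(** The geometric series, as fixed point of [d |-> 1 + d * u]; the majorant [r |-> 1 + r / 2] has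
    fixed point 2. *)
Lemma neumann u : N u <= 1 / 2 -> exists2 d, d * (1 - u) = 1 & N d <= 2.
Proof.
move=> u2.
have [|||||||d [dE Nd _]] := @majorized_fixpoint (fun d => 1 + d * u)
  (fun r => 1 + r / 2) 2 2.
- by lra.
- by [].
- by lra.
- by rewrite mul0r !addr0 mul0r addr0 (bn1 Nb).
- by move=> r s *; lra.
- move=> x y r s s0 sr rb xr ys xy.
  rewrite opprD addrACA subrr add0r -mulrBl (le_trans (bnM Nb _ _))//.
  have -> : 1 + r / 2 - (1 + s / 2) = (r - s) * (1 / 2) by lra.
  by rewrite ler_pM ?bn_ge0.
(* The gap to 2 is halved at each step, and [n + 1 <= 2 ^ n]. *)
- move=> n; apply: (@le_trans _ _ (2 / (2 ^ n)%:R)).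
    elim: n => [|n IH]; first by rewrite /= expn0; lra.
    rewrite iterS expnS natrM invfM; move: IH; set w := (2 ^ n)%:R^-1; lra.
  by rewrite ler_wpM2l// lef_pV2 ?posrE ?ltr0n ?expn_gt0// ler_nat ltn_expl.
by exists d => //; rewrite mulrBr mulr1 -{1}dE addrK.
Qed.

(* The power series of [1 - sqrt (1 - u)], obtained as the limit of
   [q' = (u + q ^ 2) / 2] with the majorant [r' = (1 + r ^ 2) / 2]. *)
Lemma sqrt_one_minus u : N u <= 1 -> exists q, [/\ (1 - q) ^+ 2 = 1 - u,
  N q <= 1 & forall c, c * u = u * c -> c * q = q * c].
Proof.
move=> u1; have a2 := @absC_half R.
have [|||||||q [qE Nq qC]] := @majorized_fixpoint
  (fun q => (2^-1 : C) *: (u + q * q)) (fun r => (1 + r ^+ 2) / 2) 1 2.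
- by lra.
- by [].
- by lra.
- rewrite mul0r addr0 expr0n addr0 (le_trans (bnZ Nb _ _))// a2; lra.
- by move=> r s *; nra.
- move=> x y r s s0 sr rb xr ys xy.
  rewrite -scalerBr opprD addrACA subrr add0r (le_trans (bnZ Nb _ _))// a2.
  have -> : x * x - y * y = x * (x - y) + (x - y) * y.
    by rewrite mulrBr mulrBl addrA subrK.
  have -> : (1 + r ^+ 2) / 2 - (1 + s ^+ 2) / 2 = 1 / 2 * (r * (r - s) + (r - s) * s).
    by field.
  rewrite ler_wpM2l// (le_trans (bnD Nb _ _))// lerD//.
    by rewrite (le_trans (bnM Nb _ _))// ler_pM ?bn_ge0.
  by rewrite (le_trans (bnM Nb _ _))// ler_pM ?bn_ge0.
- move=> n.
  (* The majorant has derivative 1 at its fixed point, so the gap [d], which becomes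
     [d - d ^ 2 / 2], decays only like [2 / (n + 2)]. *)
  have [r0 r1 rn] : [/\ 0 <= iter n (fun r : R => (1 + r ^+ 2) / 2) 0,
    iter n (fun r : R => (1 + r ^+ 2) / 2) 0 <= 1 &
    (1 - iter n (fun r : R => (1 + r ^+ 2) / 2) 0) * (n%:R + 2) <= 2].
    elim: n => [|n]; first by rewrite /=; split => //; lra.
    rewrite iterS; move: (iter n _ _) => r [r0 r1] /=.
    rewrite -(natr1 n); have : 0 <= n%:R :> R by [].
    move: (n%:R : R) => k k0 rk.
    have rr0 : 0 <= r ^+ 2 by rewrite exprn_ge0.
    have rr1 : r ^+ 2 <= 1 by rewrite expr_le1.
    split; [lra|lra|].
    have d0 : 0 <= 1 - r by lra.
    have -> : 1 - (1 + r ^+ 2) / 2 = (1 - r) - (1 - r) ^+ 2 / 2 by field.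
    move: (1 - r) d0 rk => d d0 dk.
    have m0 : 0 < k + 2 by lra.
    (* Multiplying by [k + 2] lets the difference be written as a sum of products of nonnegative
       terms. *)
    rewrite -subr_ge0 -(pmulr_rge0 _ m0).
    have -> : (k + 2) * (2 - (d - d ^+ 2 / 2) * (k + 1 + 2)) =
        (2 - d * (k + 2)) * (k + 2 - d * (k + 2) / 2) + d * (k + 2) * d / 2.
      by field.
    rewrite addr_ge0//; last by rewrite !mulr_ge0// ltW.
    by rewrite mulr_ge0//; lra.
  by rewrite ler_pdivlMr// -(natr1 n) (le_trans _ rn)// ler_wpM2l ?subr_ge0//; lra.
exists q; split => //.
- have q2 : u + q * q = q *+ 2.
    by rewrite -{3}qE -scaler_nat scalerA mulfV ?pnatr_eq0// scale1r.
  rewrite expr2 mulrBr mulr1 mulrBl mul1r.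
  by rewrite -(addrK (q * q) u) q2 mulr2n !opprD !opprK !addrA.
- move=> c cu; apply: qC => x cx.
  by rewrite -scalerAr -scalerAl mulrDr mulrDl cu mulrA cx -!mulrA cx.
Qed.

End banach.

(** * Irreducible representations *)

Section irreducible.
Variables (K : fieldType) (A : algType K) (E : lmodType K).
Variables (pi : representation A E) (pi_irr : alg_irreducible pi).

Lemma repDl a b e : pi (a + b) e = pi a e + pi b e.
Proof. by have := rep_linearl pi e 1 a b; rewrite !scale1r. Qed.

Lemma repDr a e f : pi a (e + f) = pi a e + pi a f.
Proof. by have := rep_linearr pi a 1 e f; rewrite !scale1r. Qed.

Lemma repZl c a e : pi (c *: a) e = c *: pi a e.
Proof. by have := rep_linearl pi e c a 0; rewrite !addr0 rep0l addr0. Qed.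

Lemma repZr c a e : pi a (c *: e) = c *: pi a e.
Proof. by have := rep_linearr pi a c e 0; rewrite !addr0 rep0r addr0. Qed.

Lemma repNl a e : pi (- a) e = - pi a e.
Proof. by rewrite -(scaleN1r a) repZl scaleN1r. Qed.

Lemma repNr a e : pi a (- e) = - pi a e.
Proof. by rewrite -(scaleN1r e) repZr scaleN1r. Qed.

(** The kernel of [pi 1] is invariant and is not everything because [a = 1 * a]; being zero, it
    forces [pi 1 e - e = 0]. *)
Lemma rep1 e : pi 1 e = e.
Proof.
have [[a [e0 /eqP ne]] irr] := pi_irr.
have [|b f f1|W0|WT] := irr [set e | pi 1 e = 0].
- split=> [|c u w /= u0 w0]; first exact: rep0r.
  by rewrite repDr repZr u0 w0 scaler0 addr0.
- by rewrite /= -rep_mul mul1r -(mulr1 b) rep_mul f1 rep0r.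
- apply/eqP; rewrite -subr_eq0; apply/eqP.
  have : [set e | pi 1 e = 0] (pi 1 e - e).
    by rewrite /= repDr repNr -rep_mul mulr1 subrr.
  by rewrite W0.
- exfalso; apply: ne; rewrite -(mul1r a) rep_mul.
  by have : [set e | pi 1 e = 0] (pi a e0) by rewrite WT.
Qed.

Lemma rep_cyclic v w : v <> 0 -> exists a, w = pi a v.
Proof.
move=> v0; have [_ irr] := pi_irr.
have [|b _ [a _ <-]|W0|WT] := irr (range (pi^~ v)).
- split=> [|c _ _ [a _ <-] [b _ <-]]; first by exists 0; rewrite ?rep0l.
  by exists (c *: a + b); rewrite ?repDl ?repZl.
- by exists (b * a); rewrite ?rep_mul.
- exfalso; apply: v0.
  have : range (pi^~ v) v by exists 1; rewrite ?rep1.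
  by rewrite W0.
- have [a _ <-] : range (pi^~ v) w by rewrite WT.
  by exists a.
Qed.

Lemma schur (T : E -> E) : linear T ->
  (forall a e, T (pi a e) = pi a (T e)) -> (exists e, T e <> 0) ->
  (forall e, T e = 0 -> e = 0) /\ (forall w, exists e, T e = w).
Proof.
move=> Tlin Tpi [e0 Te0]; have [_ irr] := pi_irr.
have T0 : T 0 = 0.
  by have := Tlin (-1) 0 0; rewrite scaler0 addr0 scaleN1r addrC subrr.
split=> [e Te|w].
- have [|a f /= Tf|W0|WT] := irr [set e | T e = 0].
  + split=> // c u w /= u0 w0; by rewrite Tlin u0 w0 scaler0 addr0.
  + by rewrite Tpi Tf rep0r.
  + by have : [set e | T e = 0] e by []; rewrite W0.
  + by exfalso; apply: Te0; have : [set e | T e = 0] e0 by rewrite WT.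
- have [|a _ [f _ <-]|W0|WT] := irr (range T).
  + split=> [|c _ _ [u _ <-] [u' _ <-]]; first by exists 0.
    by exists (c *: u + u'); rewrite ?Tlin.
  + by exists (pi a f); rewrite ?Tpi.
  + by exfalso; apply: Te0; have : range T (T e0) by []; rewrite W0.
  + have [e _ <-] : range T w by rewrite WT.
    by exists e.
Qed.

End irreducible.

(** * Compactness of the unit circle *)

Section circle.
Variable R : realType.
Local Notation C := (Cplx R).

Lemma closed_circle : closed (circle R).
Proof.
have -> : circle R = (@absC R) @^-1` [set 1].
  by apply/seteqP; split=> z /circleP.
apply: (preimage_closed _ (@closed_eq _ 1)) => z _; exact: absC_continuous.
Qed.

(** The circle is a closed part of the image of the square [[-1, 1] ^ 2] under
    [(a, b) |-> a + i b]. *)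
Lemma compact_circle : compact (circle R).
Proof.
pose f (p : R * R) : C := p.1 +i* p.2.
pose B := `[-1 : R, 1]%classic `*` `[-1 : R, 1]%classic.
have fc : continuous f.
  move=> p; apply/(@cvgrPdist_lt _ _ _ (nbhs p) (nbhs_filter p)) => _ /gt0C[e e0 ->].
  have e2 : 0 < e / 2 by rewrite divr_gt0.
  exists (ball p.1 (e / 2), ball p.2 (e / 2)).
    by split; exact: nbhsx_ballx.
  move=> q /= [q1 q2]; rewrite -ball_normE /= in q1; rewrite -ball_normE /= in q2.
  rewrite -absCE ltcR; have [_ _ /le_lt_trans->//] := absC_ReIm (f p - f q).
  by rewrite !raddfB /= (splitr e) ltrD.
have cB : compact (f @` B).
  apply: continuous_compact; first exact: continuous_subspaceT.
  by apply: compact_setX; exact: segment_compact.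
have -> : circle R = f @` B `&` circle R.
  apply/seteqP; split=> [z z1|z []//]; split=> //.
  have [zr zi _] := absC_ReIm z; move/circleP: (z1) => z1'.
  rewrite z1' in zr zi.
  exists (complex.Re z, complex.Im z); last by case: z {z1 z1' zr zi}.
  by split; rewrite /= in_itv /= -ler_norml.
by apply: compact_closedI => //; exact: closed_circle.
Qed.

End circle.

(** * Irreducible representations of Banach algebras *)

Section irreducible_banach.
Variables (R : realType) (A : algType (Cplx R)) (N : A -> R).
Hypothesis Nb : banach_norm N.
Local Notation C := (Cplx R).
Variables (E : lmodType C) (pi : representation A E).
Hypothesis pi_irr : alg_irreducible pi.

(** A left inverse of [1 - a] kills [v]. This is how norm estimates in [A] reach [E], which carries
    no norm. *)
Lemma rep_fix_eq0 v a : v = pi a v -> N a <= 1 / 2 -> v = 0.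
Proof.
move=> va /(neumann Nb)[d da _].
rewrite -(rep1 pi_irr v) -da rep_mul repDl (rep1 pi_irr) repNl -va subrr.
exact: rep0r.
Qed.

(** If [pi a v] is nonzero, then [v = pi (c * a) v] for some [c]. Subtracting from [a] a nearby [b]
    of the kernel keeps this identity and makes the coefficient small. *)
Lemma rep_ker_closed a :
  (forall e, 0 < e -> exists2 b, N (a - b) <= e & rep_ker pi b) -> rep_ker pi a.
Proof.
move=> acl v; apply: contrapT => av0.
have [c vc] := rep_cyclic pi_irr v av0.
have d0 : 0 < 1 / 2 / (N c + 1) by rewrite !divr_gt0// ltr_wpDl ?(bn_ge0 Nb).
have [b ab bk] := acl _ d0.
apply: av0; rewrite (@rep_fix_eq0 v (c * (a - b))) ?rep0r//.
  by rewrite rep_mul repDl repNl bk subr0.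
apply: le_trans (bnM Nb _ _) _.
have c0 : 0 < N c + 1 by rewrite ltr_wpDl ?(bn_ge0 Nb).
apply: (@le_trans _ _ ((N c + 1) * (1 / 2 / (N c + 1)))).
  by rewrite ler_pM ?(bn_ge0 Nb)// lerDl.
by rewrite mulrC divfK// gt_eqF.
Qed.

(** * A Gelfand-Mazur theorem for an element commuting with the representation *)

Section gelfand_mazur.
Variables (z z' : A).
Hypothesis zC : forall a e, pi z (pi a e) = pi a (pi z e).
Hypothesis z'zE : forall e, pi z' (pi z e) = e.
Hypothesis Nz : N z <= 1.
Hypothesis Nz' : N z' <= 1.

Lemma bn_exp_le1 a n : N a <= 1 -> N (a ^+ n) <= 1.
Proof.
by move=> Na; rewrite (le_trans (bnX Nb _ _))// exprn_ile1 ?(bn_ge0 Nb).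
Qed.

Lemma rep_expK n e : pi (z' ^+ n) (pi (z ^+ n) e) = e.
Proof.
elim: n e => [|n IH] e; first by rewrite !expr0 !(rep1 pi_irr).
by rewrite exprSr exprS !rep_mul z'zE IH.
Qed.

(* [b] represents the value at [v] of the resolvent of [pi z] at [mu]. *)
Definition resolves v (mu : C) b := pi z (pi b v) = mu *: pi b v + v.

(** Perturbation of the resolvent: [b = d * a], with [d] a left inverse of [1 - (mu - la) *: a]. *)
Lemma resolves_near v (la mu : C) a : resolves v la a ->
  absC (mu - la) * N a <= 1 / 2 ->
  exists b, [/\ resolves v mu b, N b <= 2 * N a &
    N (b - a) <= 2 * (absC (mu - la) * N a) * N a].
Proof.
move=> va la2.
have Nu : N ((mu - la) *: a) <= absC (mu - la) * N a by exact: bnZ Nb _ _.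
have [d dE Nd] := neumann Nb (le_trans Nu la2).
exists (d * a); split.
- rewrite /resolves rep_mul zC va.
  have -> : la *: pi a v + v = mu *: pi a v + pi (1 - (mu - la) *: a) v.
    rewrite repDl repNl repZl (rep1 pi_irr) scalerBl opprB addrCA.
    by rewrite [mu *: _ + _]addrC subrK addrC.
  by rewrite repDr repZr -[X in _ + X = _]rep_mul dE (rep1 pi_irr).
- by rewrite (le_trans (bnM Nb _ _))// ler_wpM2r ?(bn_ge0 Nb).
- have -> : d * a - a = d * ((mu - la) *: a) * a.
    rewrite -{2}(mul1r a) -mulrBl; congr (_ * a).
    by rewrite -{1}dE mulrBr mulr1 opprB addrC subrK.
  rewrite (le_trans (bnM Nb _ _))// ler_wpM2r ?(bn_ge0 Nb)//.
  by rewrite (le_trans (bnM Nb _ _))// ler_pM ?(bn_ge0 Nb).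
Qed.

(** Near each point of the circle the bound at most doubles; compactness makes it uniform. *)
Lemma resolvent_bound v :
  (forall la, circle R la -> exists a, resolves v la a) ->
  exists2 K, 1 <= K & forall la, circle R la -> exists2 a, resolves v la a & N a <= K.
Proof.
move=> ex_res.
have /compact_near_coveringP cov := @compact_circle R.
pose P (n : nat) (la : C) := exists2 a, resolves v la a & N a <= n%:R.
have [n _ nP] : \forall n \near \oo, (circle R : set C) `<=` P n.
  apply: cov => la /ex_res[a va].
  pose D := 1 / 2 / (N a + 1); have Na0 : 0 < N a + 1 by rewrite ltr_wpDl ?(bn_ge0 Nb).
  have D0 : 0 < D by rewrite !divr_gt0.
  have [m Nm] : exists m : nat, 2 * N a <= m%:R.
    by exists (Num.truncn (2 * N a)).+1; rewrite ltW// truncnS_gt.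
  have D0C : (0 : C) < D%:C by rewrite ltcR.
  exists (ball la D%:C, [set n | (m <= n)%N]).
    by split; [exact: (nbhsx_ballx la _ D0C)|exists m].
  move=> [mu n] /= [+ mn]; rewrite -ball_normE /= -absCE ltcR => lamu.
  have [|b [vb Nbb _]] := @resolves_near v la mu a va.
    rewrite -absCN opprB; apply: (@le_trans _ _ (D * (N a + 1))).
      by rewrite ler_pM ?absC_ge0 ?(bn_ge0 Nb)//; [exact: ltW|rewrite lerDl].
    by rewrite /D divfK// gt_eqF.
  exists b => //; rewrite (le_trans Nbb)// (le_trans Nm)// ler_nat//.
exists (n.+1)%:R; first by rewrite ler1n.
move=> la /(nP n (leqnn n))[a va Na]; exists a => //.
by rewrite (le_trans Na)// ler_nat.
Qed.

(* Rickart's argument: averaging over the [2 ^ m]-th roots of unity turns the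
   resolvents of [z] at radii [s] and [r] into those of [z ^ (2 ^ m)] at radii
   [s ^ (2 ^ m)] and [r ^ (2 ^ m)]. *)
Lemma resolvent_average v (s r : R) (eps : R) m :
  (forall th, circle R th -> exists w w' a,
    [/\ pi z w = (s%:C * th) *: (w + v), pi z w' = (r%:C * th) *: (w' + v),
        w - w' = pi a v & N a <= eps]) ->
  forall th, circle R th -> exists w w' a,
    [/\ pi (z ^+ (2 ^ m)) w = ((s ^+ (2 ^ m))%:C * th) *: (w + v),
        pi (z ^+ (2 ^ m)) w' = ((r ^+ (2 ^ m))%:C * th) *: (w' + v),
        w - w' = pi a v & N a <= eps].
Proof.
move=> h0; elim: m => [|m IH] th th1; first by rewrite expn0 !expr1; exact: h0.
(* The solutions at the two square roots [eta] and [- eta] of [th] are averaged; the terms in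
   [pi T v] cancel. *)
pose eta : C := sqrtC th.
have eta2 : eta ^+ 2 = th by exact: sqrtCK.
have eta1 : circle R eta.
  apply/circleP; apply/eqP; rewrite -(@pexpr_eq1 _ _ 2) ?absC_ge0//.
  by rewrite -absCX eta2; apply/eqP/circleP.
have eta1' : circle R (- eta) by apply/circleP; rewrite absCN; exact/circleP.
have [w1 [w1' [a1 [hw1 hw1' wa1 Na1]]]] := IH _ eta1.
have [w2 [w2' [a2 [hw2 hw2' wa2 Na2]]]] := IH _ eta1'.
set T := z ^+ (2 ^ m) in hw1 hw1' hw2 hw2' *.
have TT : z ^+ (2 ^ m.+1) = T * T by rewrite expnS mul2n -addnn exprD.
have key (x : R) u1 u2 : pi T u1 = (x%:C * eta) *: (u1 + v) ->
    pi T u2 = (x%:C * - eta) *: (u2 + v) ->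
    pi (T * T) ((2^-1 : C) *: (u1 + u2)) =
      ((x ^+ 2)%:C * th) *: ((2^-1 : C) *: (u1 + u2) + v).
  set y := x%:C * eta; rewrite mulrN -/y => h1 h2.
  have -> : (x ^+ 2)%:C * th = y * y :> C.
    by rewrite mulrACA -!expr2 eta2 rmorphXn.
  have E1 : pi (T * T) u1 = (y * y) *: (u1 + v) + y *: pi T v.
    by rewrite rep_mul h1 repZr repDr h1 scalerDr scalerA.
  have E2 : pi (T * T) u2 = (y * y) *: (u2 + v) - y *: pi T v.
    by rewrite rep_mul h2 repZr repDr h2 scalerDr scalerA mulrNN scaleNr.
  rewrite repZr repDr E1 E2 addrACA subrr addr0 -scalerDr addrACA scalerA.
  rewrite [_^-1 * _]mulrC -(scalerA (y * y)); congr (_ *: _).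
  rewrite scalerDr; congr (_ + _).
  have -> : v + v = (2 : C) *: v by rewrite scaler_nat mulr2n.
  by rewrite scalerA mulVf ?pnatr_eq0// scale1r.
have a2e := @absC_half R.
exists ((2^-1 : C) *: (w1 + w2)), ((2^-1 : C) *: (w1' + w2')), ((2^-1 : C) *: (a1 + a2)).
rewrite TT expnSr !exprM; split.
- exact: key.
- exact: key.
- by rewrite -scalerBr opprD addrACA wa1 wa2 repZl repDl.
- rewrite (le_trans (bnZ Nb _ _))// a2e.
  have := le_trans (bnD Nb a1 a2) (lerD Na1 Na2); lra.
Qed.
(** If no [la] works, Schur's lemma makes each [pi z - la] surjective, hence resolvents at [v] exist
    on the whole circle, with a common bound [K]. Averages at radii [1 + h] and [1 - h] differ by a
    coefficient of norm at most 1/8, while for a high power the first is close to [- v] and the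
    second to 0; so [v = 0]. *)
Lemma gelfand_mazur : exists2 la, circle R la & forall e, pi z e = la *: e.
Proof.
apply: contrapT => no_la.
have [[a0 [v0 /eqP av0]] _] := pi_irr.
pose v := pi a0 v0; have vn0 : v <> 0 by [].
have res la : circle R la -> exists a, resolves v la a.
  move=> la1; have [|||_ Tsurj] := schur (T := fun e => pi z e - la *: e) pi_irr.
  - move=> c u w; rewrite repDr repZr scalerDr scalerBr !scalerA mulrC.
    by rewrite opprD addrACA.
  - by move=> a e; rewrite repDr repNr repZr zC.
  - apply: contrapT => T0; apply: no_la; exists la => // e.
    apply/eqP; rewrite -subr_eq0; apply/eqP; apply: contrapT => Te.
    by apply: T0; exists e.
  - have [w Tw] := Tsurj v; have [a wa] := rep_cyclic pi_irr w vn0.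
    by exists a; rewrite /resolves -wa -Tw addrC subrK.
have [K K1 resK] := resolvent_bound res.
have K0 : 0 < K by lra.
(* With [h * K ^ 2 = 1 / 64], moving from [b] to [d] and to [d'] costs 1/32 each and the change of
   radius at most 1/16, which add up to 1/8. *)
pose h := 1 / (64 * K ^+ 2).
have hK2 : h * K ^+ 2 = 1 / 64.
  by rewrite /h; field; rewrite gt_eqF.
have h0 : 0 < h by rewrite divr_gt0// mulr_gt0// exprn_gt0.
clearbody h.
have hK : h * K <= 1 / 64.
  rewrite -hK2 ler_wpM2l ?(ltW h0)//; rewrite expr2 ler_peMl// ltW//.
have h64 : h <= 1 / 64 by apply: le_trans hK; rewrite ler_peMr// ltW.
have base th : circle R th -> exists w w' a,
    [/\ pi z w = ((1 + h)%:C * th) *: (w + v), pi z w' = ((1 - h)%:C * th) *: (w' + v),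
        w - w' = pi a v & N a <= 1 / 8].
  move=> th1; have [b vb Nbb] := resK _ th1.
  have near_b (x : R) : `|x| = h -> exists d, [/\ resolves v ((1 + x)%:C * th) d,
      N d <= 2 * K & N (d - b) <= 2 * (h * K) * K].
    move=> xh.
    have dist : absC ((1 + x)%:C * th - th) = h.
      rewrite rmorphD rmorph1 mulrDl mul1r addrAC subrr add0r absCM absC_real.
      by move/circleP: th1 => ->; rewrite mulr1.
    have hb : h * N b <= h * K by rewrite ler_wpM2l ?(ltW h0).
    have [|d [vd Nd Ndb]] := @resolves_near v th ((1 + x)%:C * th) b vb.
      by rewrite dist; lra.
    exists d; split=> //; first by rewrite (le_trans Nd)// ler_wpM2l.
    rewrite dist in Ndb; apply: le_trans Ndb _.
    have hb0 : 0 <= h * N b by rewrite mulr_ge0 ?(bn_ge0 Nb) ?(ltW h0).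
    by apply: ler_pM => //; rewrite ?(bn_ge0 Nb)//; lra.
  have [|d [vd Nd Ndb]] := near_b h; first by rewrite ger0_norm// ltW.
  have [|d' [vd' Nd' Ndb']] := near_b (- h); first by rewrite normrN ger0_norm// ltW.
  pose y := (1 + h)%:C * th; pose y' := (1 - h)%:C * th.
  exists (y *: pi d v), (y' *: pi d' v), (y *: d - y' *: d'); split.
  - by rewrite repZr vd.
  - by rewrite repZr vd'.
  - by rewrite repDl repNl !repZl.
  - have -> : y *: d - y' *: d' =
        th *: ((d - b) - (d' - b)) + (h%:C * th) *: (d + d').
      rewrite opprB addrA subrK /y /y' rmorphD rmorphB rmorph1 mulrDl mulrBl mul1r.
      rewrite scalerDl scalerBl scalerBr scalerDr opprB [RHS]addrACA.
      by congr (_ + _); rewrite addrC.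
    apply: le_trans (bnD Nb _ _) _.
    have /le_trans n1 := bnZ Nb th ((d - b) - (d' - b)).
    have /le_trans n2 := bnZ Nb (h%:C * th) (d + d').
    apply: le_trans (lerD (n1 _ (lexx _)) (n2 _ (lexx _))) _.
    rewrite absCM absC_real; move/circleP: th1 => ->; rewrite mulr1 mul1r.
    rewrite ger0_norm ?(ltW h0)//.
    have e1 := bnB Nb (d - b) (d' - b); have e2 := bnD Nb d d'.
    have e3 : h * N (d + d') <= h * (4 * K).
      by rewrite ler_wpM2l ?(ltW h0)//; lra.
    have e4 : 2 * (h * K) * K = 2 / 64.
      by rewrite -mulrA -[h * K * K]mulrA -expr2 hK2; lra.
    rewrite e4 in Ndb Ndb'.
    lra.
(* Bernoulli's inequality, to make [(1 + h) ^+ (2 ^ m)] exceed 32. *)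
have bern n : 1 + n%:R * h <= (1 + h) ^+ n.
  elim: n => [|n IH]; first by rewrite mul0r addr0 expr0.
  have h1 : 0 <= 1 + h by lra.
  have nh : 0 <= n%:R * h * h by rewrite !mulr_ge0// ltW.
  rewrite exprS -(natr1 n) (le_trans _ (ler_wpM2l h1 IH))//.
  by move: nh; move: (n%:R : R) => k; nra.
have [m hm] : exists m, 32 <= (1 + h) ^+ (2 ^ m).
  exists (Num.truncn (32 / h)).+1; apply: le_trans (bern _).
  apply: (@le_trans _ _ ((Num.truncn (32 / h)).+1%:R * h)).
    by rewrite -ler_pdivrMr// ltW// truncnS_gt.
  apply: (@le_trans _ _ ((2 ^ (Num.truncn (32 / h)).+1)%:R * h)).
    by rewrite ler_wpM2r ?(ltW h0)// ler_nat ltnW// ltn_expl.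
  by rewrite lerDr.
have c1 : circle R 1 by apply/circleP; rewrite absC1.
have [w [w' [a [hw hw' wa Na]]]] := resolvent_average m base c1.
rewrite !mulr1 in hw hw'.
set n := (2 ^ m)%N in hm hw hw'.
set s := (1 + h) ^+ n in hm hw; set r := (1 - h) ^+ n in hw'.
have s0 : 0 < s by lra.
have r0 : 0 <= r by rewrite exprn_ge0//; lra.
(* Since [r * s = (1 - h ^ 2) ^ n <= 1]. *)
have r32 : r <= 1 / 32.
  have : r * s <= 1.
    rewrite -exprMn; apply: exprn_ile1; last by nra.
    by rewrite mulr_ge0//; lra.
  nra.
apply: vn0.
pose u : A := (s^-1)%:C *: z ^+ n; pose u' : A := r%:C *: z' ^+ n.
have Nu : N u <= 1 / 32.
  apply: le_trans (bnZ Nb _ _) _; rewrite absC_real ger0_norm ?invr_ge0 ?(ltW s0)//.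
  apply: (@le_trans _ _ s^-1); first by rewrite ler_piMr ?invr_ge0 ?(ltW s0) ?bn_exp_le1.
  by rewrite div1r lef_pV2 ?posrE.
have Nu' : N u' <= 1 / 32.
  apply: le_trans (bnZ Nb _ _) _; rewrite absC_real ger0_norm//.
  by apply: le_trans r32; rewrite ler_piMr ?bn_exp_le1.
have [d dE Nd] : exists2 d, d * (1 - u) = 1 & N d <= 2 by apply: neumann => //; lra.
have [d' dE' Nd'] : exists2 d, d * (1 - u') = 1 & N d <= 2.
  by apply: neumann => //; lra.
have uw : pi u w = w + v.
  by rewrite repZl hw scalerA -rmorphM /= mulVf ?gt_eqF// scale1r.
have uw' : w' = pi u' w' + pi u' v.
  by rewrite -repDr repZl -repZr -hw' rep_expK.
have wE : w = - pi d v.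
  rewrite -{1}(rep1 pi_irr w) -dE rep_mul repDl (rep1 pi_irr) repNl uw.
  by rewrite opprD addrA subrr add0r repNr.
have wE' : w' = pi (d' * u') v.
  rewrite -{1}(rep1 pi_irr w') -dE' !rep_mul repDl (rep1 pi_irr) repNl.
  by rewrite {1}uw' addrAC subrr add0r.
(* From [v = pi u w - w], [w = - pi d v] and [w = w' + pi a v]. The three terms have norms at most
   1/16, 1/16 and 1/8. *)
apply: (@rep_fix_eq0 v (- (u * d) - d' * u' - a)).
  rewrite !repDl !repNl -wa -wE' rep_mul -repNr -wE uw.
  by rewrite opprB addrA subrK addrAC subrr add0r.
have e1 := bnB Nb (- (u * d) - d' * u') a.
have e2 := bnB Nb (- (u * d)) (d' * u'); rewrite bnN// in e2.
have e3 : N (u * d) <= 1 / 32 * 2.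
  by rewrite (le_trans (bnM Nb _ _))// ler_pM ?(bn_ge0 Nb).
have e4 : N (d' * u') <= 2 * (1 / 32).
  by rewrite (le_trans (bnM Nb _ _))// ler_pM ?(bn_ge0 Nb).
lra.
Qed.

End gelfand_mazur.
End irreducible_banach.

(** * Primitive ideals defined by functionals *)

Section functional_module.
Variables (K : fieldType) (A : algType K) (phi : {linear A -> K^o}).

(* The cyclic submodule of the dual of [A] generated by [phi], for the action
   [(a xi)(b) = xi (b a)]. *)
Definition cyclic_dual_pred : {pred A -> K^o} :=
  fun xi => `[< exists a, xi = fun b => phi (b * a) >].

Record cyclic_dual := CyclicDual {
  cyclic_dual_val :> A -> K^o; _ : cyclic_dual_val \in cyclic_dual_pred }.

HB.instance Definition _ := [isSub for cyclic_dual_val].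
HB.instance Definition _ := [Choice of cyclic_dual by <:].

Lemma cyclic_dual_submod : submod_closed cyclic_dual_pred.
Proof.
split=> [|c _ _ /asboolP[a ->] /asboolP[b ->]]; apply/asboolP.
  by exists 0; apply/funext => b; rewrite mulr0 linear0.
exists (c *: a + b); apply/funext => d.
by rewrite mulrDr -scalerAr linearP.
Qed.

HB.instance Definition _ :=
  GRing.SubChoice_isSubLmodule.Build K (A -> K^o) cyclic_dual_pred cyclic_dual
    cyclic_dual_submod.

Lemma cyclic_dual_act_subproof (a : A) (xi : cyclic_dual) :
  (fun b => xi (b * a)) \in cyclic_dual_pred.
Proof.
case: xi => xi /= /asboolP[c ->]; apply/asboolP; exists (a * c).
by apply/funext => b; rewrite mulrA.
Qed.

Definition cyclic_dual_act a xi := CyclicDual (cyclic_dual_act_subproof a xi).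

Lemma cyclic_dualP (xi zeta : cyclic_dual) : (forall b, xi b = zeta b) -> xi = zeta.
Proof. by move=> h; apply/val_inj/funext. Qed.

Lemma cyclic_dual_lin (xi : cyclic_dual) : linear xi.
Proof.
case: xi => xi /= /asboolP[d ->] c a b.
by rewrite mulrDl -scalerAl linearP.
Qed.

Lemma cyclic_dual_linl xi : linear (cyclic_dual_act^~ xi).
Proof.
move=> c a b; apply: cyclic_dualP => d /=.
by rewrite mulrDr -scalerAr cyclic_dual_lin.
Qed.

Lemma cyclic_dual_linr a : linear (cyclic_dual_act a).
Proof. by move=> c xi zeta; apply: cyclic_dualP. Qed.

Lemma cyclic_dual_mul a b xi :
  cyclic_dual_act (a * b) xi = cyclic_dual_act a (cyclic_dual_act b xi).
Proof. by apply: cyclic_dualP => d /=; rewrite mulrA. Qed.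

Definition cyclic_dual_rep :=
  Representation cyclic_dual_linl cyclic_dual_linr cyclic_dual_mul.

(** A nonzero [xi = a phi] has [phi (b * a) != 0] for some [b], and then
    [(e * b) xi = phi (b * a) phi]. So every nonzero vector gives back the generator, which proves
    irreducibility. *)
Lemma primitive_functional (e : A) : phi 1 = 1 ->
  (forall c d, phi (c * e * d) = phi c * phi d) ->
  primitive_ideal [set a | forall b c, phi (b * a * c) = 0].
Proof.
move=> phi1 phiM; exists cyclic_dual, cyclic_dual_rep.
have phi_in : (phi : A -> K^o) \in cyclic_dual_pred.
  by apply/asboolP; exists 1; apply/funext => b; rewrite mulr1.
pose Phi := CyclicDual phi_in.
have gen (xi : cyclic_dual) : exists a, xi = cyclic_dual_act a Phi.
  case: xi => xi xiP; have /asboolP[a xiE] := xiP; exists a.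
  by apply: cyclic_dualP => b /=; rewrite xiE.
split; [split|].
- exists 1, Phi; apply/eqP => /(congr1 (fun xi : cyclic_dual => xi 1)) /=.
  by rewrite mulr1 phi1 => /eqP; rewrite oner_eq0.
- move=> W [W0 Wlin] Wact.
  have [WE|/existsNP[xi /not_implyP[Wxi xi0]]] :=
    pselect (forall xi, W xi -> xi = 0).
    by left; apply/seteqP; split=> xi; [exact: WE|move=> ->].
  right; apply/seteqP; split=> // zeta _.
  have [a xiE] := gen xi.
  have [b bxi] : exists b, phi (b * a) != 0.
    apply: contrapT => nb; apply: xi0; rewrite xiE; apply: cyclic_dualP => b /=.
    by apply/eqP; apply: contrapT => /negP h; apply: nb; exists b.
  have [d ->] := gen zeta; apply: (Wact).
  have -> : Phi = (phi (b * a))^-1 *: cyclic_dual_act (e * b) xi + 0.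
    rewrite addr0; apply: cyclic_dualP => c.
    rewrite -[RHS]/((phi (b * a))^-1 * xi (c * (e * b))) xiE /=.
    by rewrite mulrA -(mulrA (c * e)) phiM mulrCA mulVf// mulr1.
  by apply: Wlin => //; exact: Wact.
- apply/seteqP; split=> a /= h.
    move=> xi; have [c ->] := gen xi; apply: cyclic_dualP => b /=.
    exact: h.
  move=> b c; have := h (cyclic_dual_act c Phi).
  by move/(congr1 (fun xi : cyclic_dual => xi b)).
Qed.

End functional_module.

(** * Monomials *)

Section monomials.
Variables (R : realType) (S : dynSystem).
Local Notation C := (Cplx R).
Local Notation CX := (cfun R S).
Local Notation A := (l1 R S).

Definition mono_fun (f : CX) (k n : int) : CX := if n == k then f else 0.

Lemma sum_mono_fun_le f k (B : {fset int}) :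
  \sum_(n <- B) rnorm (mono_fun f k n) <= rnorm f.
Proof.
have [kB|kB] := boolP (k \in B).
  rewrite (big_fsetD1 k)//= {1}/mono_fun eqxx big1_fset ?addr0// => n.
  by rewrite !inE /mono_fun => /andP[/negPf ->] _ _; exact: rnorm0.
rewrite big1_fset ?rnorm_ge0// => n nB _; rewrite /mono_fun.
by case: eqP => [nk|_]; [rewrite -nk nB in kB|exact: rnorm0].
Qed.

Lemma mono_subproof f k : mono_fun f k \in @l1pred R S.
Proof.
rewrite l1predP; apply: (@le_lt_trans _ _ (rnorm f)%:E); last exact: ltry.
by apply: esum_le_fset => B; exact: sum_mono_fun_le.
Qed.

(* The element [f delta ^ k], where [delta] implements [alpha]. *)
Definition mono f k : A := L1 (mono_subproof f k).

Lemma monoE f k n : mono f k n = if n == k then f else 0.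
Proof. by []. Qed.

Lemma l1norm_mono f k : l1norm (mono f k) <= rnorm f.
Proof. by apply: l1norm_le => B; exact: sum_mono_fun_le. Qed.

Lemma mono1 : 1 = mono 1 0 :> A.
Proof. exact: l1P. Qed.

Lemma mono_linear k : linear (mono^~ k).
Proof.
move=> c f g; apply: l1P => n.
rewrite -[RHS]/(c *: mono f k n + mono g k n) !monoE.
by case: eqP => // _; rewrite scaler0 addr0.
Qed.

Lemma mono0 k : mono 0 k = 0.
Proof. by apply: l1P => n; rewrite monoE; case: eqP. Qed.

Lemma monoD f g k : mono (f + g) k = mono f k + mono g k.
Proof. by have := mono_linear k 1 f g; rewrite !scale1r. Qed.

Lemma monoZ c f k : mono (c *: f) k = c *: mono f k.
Proof. by have := mono_linear k c f 0; rewrite mono0 !addr0. Qed.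

Lemma monoM f k g l : mono f k * mono g l = mono (f * alpha k g) (k + l).
Proof.
apply: l1P => n; rewrite l1mulE; apply: hsum_sum.
have := @hsum1 _ _ _ (fun j => mono f k j * alpha j (mono g l (n - j))) k.
rewrite monoE eqxx !monoE subr_eq [l + k]addrC.
have -> : f * alpha k (if n == k + l then g else 0) =
    if n == k + l then f * alpha k g else 0.
  by case: eqP => // _; rewrite alpha_zero mulr0.
by apply=> j /negPf jk; rewrite monoE jk mul0r.
Qed.

Lemma l1_approx (a : A) (e : R) : 0 < e ->
  exists B : {fset int}, l1norm (a - \sum_(k <- B) mono (a k) k) <= e.
Proof.
move=> e0; have [B hB] := esum_tail (fun n => rnorm_ge0 (a n)) (l1_asum a) e0.
exists B; apply: l1norm_le => D.
set b := \sum_(k <- B) _.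
have sumE n : b n = if n \in B then a n else 0.
  rewrite /b (big_morph (fun b : A => b n) (id1 := 0) (op1 := +%R))//.
  have [nB|nB] := boolP (n \in B).
    rewrite (big_fsetD1 n)//= /mono_fun eqxx big1_fset ?addr0// => k.
    by rewrite !inE eq_sym => /andP[/negPf ->].
  rewrite big1_fset// => k kB _; rewrite /= /mono_fun.
  by case: eqP => // nk; rewrite nk kB in nB.
have -> : \sum_(n <- D) rnorm ((a - b) n) =
    \sum_(n <- D) if n \in B then 0 else rnorm (a n).
  apply: eq_bigr => n _; rewrite (_ : (a - b) n = a n - b n)// sumE.
  by case: ifP => _; rewrite ?subrr ?subr0 ?rnorm0.
have /ltW := hB (D `|` B)%fset (fsubsetUr _ _).
rewrite sum_fset_sub ?fsubsetUr//; apply: le_trans.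
have -> : [fset i in (D `|` B)%fset | i \notin B]%fset = (D `\` B)%fset.
  by apply/fsetP => i; rewrite !inE /=; case: (i \in B); rewrite ?andbF ?orbF ?andbT.
rewrite (big_fsetID _ (mem B) D) /= [X in X + _]big1_fset ?add0r; last first.
  by move=> n; rewrite !inE /= => /andP[_ ->].
rewrite le_eqVlt; apply/orP; left; apply/eqP.
have -> : [fset i in D | i \notin B]%fset = (D `\` B)%fset.
  by apply/fsetP => i; rewrite !inE /= andbC.
by rewrite !big_seq; apply: eq_bigr => n; rewrite !inE => /andP[/negPf ->].
Qed.

(** Truncations of [a] are finite sums of monomials and converge to [a] in norm. *)
Lemma l1_ind (P : set A) : subspace_of P ->
  (forall a, (forall e, 0 < e -> exists2 b, l1norm (a - b) <= e & P b) -> P a) ->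
  (forall f k, P (mono f k)) -> forall a, P a.
Proof.
move=> [P0 Plin] Pcl Pmono a; apply: Pcl => e /(l1_approx a)[B aB].
exists (\sum_(k <- B) mono (a k) k) => //.
elim/big_ind: _ => // b c Pb Pc.
by rewrite -(scale1r b); exact: Plin.
Qed.

Lemma rnorm1_le : rnorm (1 : CX) <= 1.
Proof.
by rewrite -supnorm_rnorm; apply: supnorm_le => x; rewrite cfun1E absC1.
Qed.

Lemma l1_banach_norm : banach_norm (@l1norm R S).
Proof.
split.
- move=> a a0; apply: l1P => n; apply: rnorm_eq0; apply/eqP.
  by rewrite eq_le rnorm_ge0 andbT (le_trans (coef_le_l1norm a n)).
- exact: l1normD.
- exact: l1normZ_le.
- exact: l1normM.
- by rewrite mono1 (le_trans (l1norm_mono _ _))// rnorm1_le.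
- exact: l1_complete.
Qed.

Section pairing.
Variables (x : S) (chi : int -> C).
Hypothesis chi1 : forall n, absC (chi n) <= 1.

Lemma pairing_hsum (a : A) :
  hsum (fun n => chi n *: (a n : CX)) (summability.sum (fun n => chi n *: (a n : CX))).
Proof.
apply: asum_hsum; apply: le_lt_trans (l1_asum a).
apply: le_esum => n _; rewrite lee_fin rnormZ ler_piMl ?rnorm_ge0//.
Qed.

(** Summation takes place in C(X), before evaluation at [x], so that the results on [hsum] apply. *)
Definition pairing (a : A) : C := (summability.sum (fun n => chi n *: (a n : CX))) x.

Lemma pairing_linear : linear (pairing : A -> C^o).
Proof.
move=> c a b; rewrite /pairing.
have hZ := hsum_bounded (M := absC c) (f := fun f : CX => c *: f)
  (fun f g => scalerBr c f g) _ (pairing_hsum a).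
have -> : summability.sum (fun n => chi n *: ((c *: a + b) n : CX)) =
    c *: summability.sum (fun n => chi n *: (a n : CX)) +
    summability.sum (fun n => chi n *: (b n : CX)).
  apply: hsum_sum; apply: hsum_eq (hsumD (hZ _) (pairing_hsum b)) => [n|f].
    by rewrite /= scalerDr !scalerA mulrC.
  by rewrite rnormZ.
by [].
Qed.

Lemma pairing_le a : absC (pairing a) <= l1norm a.
Proof.
apply: le_trans (le_supnorm _ x) _; rewrite supnorm_rnorm.
apply: hsum_le (pairing_hsum a) _ => B.
apply: le_trans (sum_le_l1norm a B); apply: ler_sum => n _.
by rewrite rnormZ ler_piMl ?rnorm_ge0.
Qed.

Lemma pairing_mono f k : pairing (mono f k) = chi k * f x.
Proof.
rewrite /pairing (hsum_sum (l := chi k *: f))//.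
have := @hsum1 _ _ _ (fun n => chi n *: (mono f k n : CX)) k.
rewrite /= /mono_fun eqxx; apply=> n /negPf ->; exact: scaler0.
Qed.

End pairing.
End monomials.

(** * Evaluation functionals *)

Section l1_ext.
Variables (R : realType) (S : dynSystem).
Local Notation C := (Cplx R).
Local Notation A := (l1 R S).

(** Density of the monomials. The target is measured by a bare function [nV], so that the lemma
    serves for [A] itself as well as for the scalars. *)
Lemma l1_ext (V : lmodType C) (nV : V -> R) (F : A -> V) (M : R) :
  (forall v, nV v <= 0 -> v = 0) -> linear F ->
  (forall a, nV (F a) <= M * l1norm a) -> (forall f k, F (mono f k) = 0) ->
  forall a, F a = 0.
Proof.
move=> nV0 Flin FM; have Nb := l1_banach_norm R S.
have F0 : F 0 = 0.
  by have := Flin (-1) 0 0; rewrite scaler0 addr0 scaleN1r addrC subrr.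
have FB a b : F (a - b) = F a - F b.
  by rewrite [a - b]addrC -(scaleN1r b) Flin scaleN1r addrC.
apply: l1_ind => [|a acl].
  by split=> // c a b Fa Fb; rewrite Flin Fa Fb scaler0 addr0.
apply: nV0; apply/ler_addgt0Pr => e e0; rewrite add0r.
have M0 : 0 < `|M| + 1 by rewrite ltr_wpDl.
have [b ab Fb] := acl _ (divr_gt0 e0 M0).
have := FM (a - b); rewrite FB Fb subr0 => /le_trans; apply.
apply: (@le_trans _ _ ((`|M| + 1) * (e / (`|M| + 1)))).
  apply: (@le_trans _ _ ((`|M| + 1) * l1norm (a - b))).
    by rewrite ler_wpM2r ?l1norm_ge0// (le_trans (ler_norm _))// lerDl.
  by rewrite ler_wpM2l// ltW.
by rewrite mulrC divfK// gt_eqF.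
Qed.

(** On monomials [f delta ^ l], invariance of [g] leaves [g y * f (sigma ^ (-k) y)] to be compared
    with [f y * g y]; these agree because [sigma ^ (-k)] fixes the support of [g]. *)
Lemma mono_central (g : cfun R S) k :
  (forall y, g y != 0 -> zpow (sigma S) (- k) y = y) ->
  (forall l y, g (zpow (sigma S) l y) = g y) ->
  forall a : A, mono g k * a = a * mono g k.
Proof.
move=> gk ginv a; apply/eqP; rewrite -subr_eq0; apply/eqP; move: a.
have Nb := l1_banach_norm R S.
apply: (@l1_ext A (@l1norm R S) (fun a => mono g k * a - a * mono g k)
  (l1norm (mono g k) + l1norm (mono g k))) => [v|c a b|a|f l].
- exact: bn_eq0 Nb _.
- by rewrite mulrDr mulrDl -scalerAr -scalerAl opprD addrACA -scalerBr.
- rewrite (le_trans (bnB Nb _ _))// mulrDl lerD ?l1normM//.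
  by rewrite mulrC l1normM.
- rewrite !monoM [l + k]addrC; apply/eqP; rewrite subr_eq0; apply/eqP.
  congr mono; apply: cfunP => y; rewrite !cfunME !alphaE ginv.
  have [->|/gk ->] := eqVneq (g y) 0; first by rewrite mul0r mulr0.
  exact: mulrC.
Qed.

End l1_ext.

Section finite_system.
Variables (R : realType) (S : dynSystem).
Hypothesis finS : finite_set [set: S].
Local Notation C := (Cplx R).
Local Notation CX := (cfun R S).
Local Notation A := (l1 R S).
Local Notation "n \act x" := (zpow (sigma S) n x) (at level 38, right associativity).

(** A finite Hausdorff space is discrete: the complement of a point is finite, hence closed. *)
Lemma finite_continuous (g : S -> C) : continuous g.
Proof.
move=> x U /nbhs_singleton gU.
have : open (~` (setT `\ x)).
  have /accessible_finite_set_closed h := hausdorff_accessible (@space_hausdorff S).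
  by rewrite openC; apply: h; exact: finite_setD.
move=> o; have xo : (~` (setT `\ x)) x by case=> _; apply.
apply: filterS (open_nbhs_nbhs (conj o xo)) => y /not_andP[/(_ I)[]|/contrapT ->].
exact: gU.
Qed.

Definition cfun_of (g : S -> C) : CX := CFun (introT (contfP g) (@finite_continuous g)).

Definition indicator (P : set S) : CX := cfun_of (fun y => if `[< P y >] then 1 else 0).

Lemma indicatorE P y : indicator P y = if `[< P y >] then 1 else 0.
Proof. by []. Qed.

Lemma rnorm_indicator P : rnorm (indicator P) <= 1.
Proof.
rewrite -supnorm_rnorm; apply: supnorm_le => y; rewrite indicatorE.
by case: ifP => _; rewrite ?absC1 ?absC0.
Qed.

Lemma zpowK n : cancel (zpow (sigma S) n) (zpow (sigma S) (- n)).
Proof. by move=> x; rewrite -zpowD addNr. Qed.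

(** By finiteness two forward iterates of [x] coincide. Euclidean division by the least positive
    return time gives the equivalence for all integers. *)
Lemma period_exists (x : S) : exists p : nat, (0 < p)%N /\
  forall n : int, n \act x = x <-> (p %| n)%Z.
Proof.
have [p0 p0P] : exists p, (0 < p)%N && (p%:Z \act x == x).
  apply: contrapT => np; apply: infinite_nat.
  have inj : injective (fun n : nat => n%:Z \act x).
    suff h i j : (i < j)%N -> i%:Z \act x <> j%:Z \act x.
      move=> i j ij; case: (ltngtP i j) => [/h[]|/h[]|//]; first exact: ij.
      exact: esym ij.
    move=> ij eij; apply: np; exists (j - i)%N; rewrite subn_gt0 ij andTb.
    apply/eqP; rewrite -subzn ?(ltnW ij)// addrC zpowD -eij.
    exact: zpowK.
  have := @finite_preimage _ _ setT (fun n : nat => n%:Z \act x) (in2W inj) finS.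
  by rewrite preimage_setT.
have := ex_intro (fun p => (0 < p)%N && (p%:Z \act x == x)) p0 p0P.
case/ex_minnP => p /andP[p_gt0 /eqP px] pmin; exists p; split=> // n.
have qx (q : int) : (q * p%:Z) \act x = x.
  elim/int_rect: q => [|q IH|q IH].
  - by rewrite mul0r.
  - by rewrite -addn1 PoszD mulrDl mul1r zpowD px IH.
  - rewrite -addn1 PoszD opprD mulrDl mulN1r zpowD.
    by rewrite -{1}px zpowK.
split=> [nx|/dvdzP[q ->]]; last exact: qx.
apply/dvdz_mod0P; have p0' : p%:Z != 0 by rewrite eqz_nat -lt0n.
have rx : (n %% p)%Z \act x = x.
  have := nx; rewrite {1}(divz_eq n p) addrC zpowD qx => ->//.
have := modz_ge0 n p0'; have := ltz_pmod n (d := p) p_gt0.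
case: (n %% p)%Z rx => // r rx; rewrite ltz_nat => rp _.
case: r rx rp => // r rx; rewrite ltnNge => /negP[].
by apply: pmin; apply/andP; split=> //; apply/eqP.
Qed.

Definition period (x : S) : nat := xget 1%N
  [set p | (0 < p)%N /\ forall n : int, n \act x = x <-> (p %| n)%Z].

Lemma periodP x : (0 < period x)%N /\ forall n : int, n \act x = x <-> (period x %| n)%Z.
Proof. exact: (xgetPex 1%N (period_exists x)). Qed.

Lemma period_gt0 x : (0 < period x)%N. Proof. by case: (periodP x). Qed.

Lemma zpow_period x n : n \act x = x <-> (period x %| n)%Z.
Proof. by case: (periodP x). Qed.

Lemma zpow_orbit x y n : zorbit (sigma S) x y -> n \act x = x -> n \act y = y.
Proof. by move=> [k _ <-] nx; rewrite -zpowD addrC zpowD nx. Qed.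

Lemma zorbit_zpow x y n : zorbit (sigma S) x (n \act y) <-> zorbit (sigma S) x y.
Proof.
split=> [[k _ kE]|[k _ <-]]; last by exists (n + k); rewrite ?zpowD.
by exists (- n + k) => //; rewrite zpowD kE zpowK.
Qed.

Section evaluation.
Variables (x : S) (la : circle R).

Lemma absC_circle : absC (val la) = 1.
Proof. by apply/circleP; exact: set_valP. Qed.

Lemma circle_neq0 : val la != 0 :> C.
Proof. exact: absC1_neq0 absC_circle. Qed.

(** The character [j * p |-> la ^ j] of the stabilizer of [x], extended by zero to all integers. *)
Definition orbit_char (n : int) : C :=
  if (period x %| n)%Z then (val la : C) ^ (n %/ period x)%Z else 0.

Lemma absC_orbit_char n : absC (orbit_char n) <= 1.
Proof.
rewrite /orbit_char; case: ifP => _; last by rewrite absC0.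
by case: (n %/ _)%Z => k /=; rewrite ?absCV absCX absC_circle expr1n ?invr1.
Qed.

(* [ev a] is the sum over [j] of [a (j * p) x * la ^ j], with [p] the period of
   [x]. *)
Definition ev (a : A) : C := pairing x orbit_char a.

Lemma ev_linear : linear (ev : A -> C^o).
Proof. exact: pairing_linear absC_orbit_char. Qed.

HB.instance Definition _ := GRing.isLinear.Build C A C^o _ (ev : A -> C^o) ev_linear.

Lemma evB a b : ev (a - b) = ev a - ev b.
Proof. exact: (linearB (ev : {linear A -> C^o})). Qed.

Lemma evD a b : ev (a + b) = ev a + ev b.
Proof. exact: (linearD (ev : {linear A -> C^o})). Qed.

Lemma evZ c a : ev (c *: a) = c * ev a.
Proof. exact: (linearZ_LR (ev : {linear A -> C^o})). Qed.

Lemma ev_le a : absC (ev a) <= l1norm a.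
Proof. exact: pairing_le absC_orbit_char a. Qed.

Lemma ev_mono f k : ev (mono f k) = orbit_char k * f x.
Proof. exact: pairing_mono. Qed.

Lemma orbit_charD k l : (period x %| k)%Z ->
  orbit_char (k + l) = orbit_char k * orbit_char l.
Proof.
move=> pk; rewrite /orbit_char rpredDl// pk.
case: ifP => [pl|_]; last by rewrite mulr0.
by rewrite divzDl// expfzDr// circle_neq0.
Qed.

Lemma orbit_char_mul j : orbit_char (j * (period x)%:Z) = (val la : C) ^ j.
Proof.
by rewrite /orbit_char dvdz_mull// mulzK// eqz_nat -lt0n period_gt0.
Qed.

Lemma orbit_char0 : orbit_char 0 = 1.
Proof. by rewrite -(mul0r (period x)%:Z) orbit_char_mul. Qed.

Lemma ev1 : ev 1 = 1.
Proof. by rewrite mono1 ev_mono cfun1E mulr1 orbit_char0. Qed.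

Definition point_proj : A := mono (indicator [set x]) 0.

(* [ev] is the character of the commutative corner
   [point_proj * A * point_proj], a copy of the Wiener algebra. *)
Lemma evM c d : ev (c * point_proj * d) = ev c * ev d.
Proof.
have Nb := l1_banach_norm R S.
have nC (v : C^o) : absC v <= 0 -> v = 0.
  by move=> v0; apply: absC_eq0; apply/eqP; rewrite eq_le v0 absC_ge0.
have prodle (r s t u : R) : 0 <= t -> 0 <= s -> r <= s -> t <= u -> r * t <= s * u.
  by move=> t0 s0 rs tu; apply: le_trans (ler_wpM2r t0 rs) (ler_wpM2l s0 tu).
(* Both sides are linear and bounded in [c] and in [d], so both may be taken to be monomials, one
   after the other. *)
apply/eqP; rewrite -subr_eq0; apply/eqP; move: c.
apply: (@l1_ext R S C^o (@absC R) (fun c => ev (c * point_proj * d) - ev c * ev d)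
  (l1norm point_proj * l1norm d + l1norm d)) => // [r a b|a|f k].
- rewrite !mulrDl -!scalerAl !linearP /= mulrDl scalerBr opprD addrACA.
  by rewrite -[X in _ - X + _]scalerAl.
- rewrite (le_trans (absCD _ _))// absCN absCM mulrDl lerD//.
    rewrite (le_trans (ev_le _))// -mulrA (le_trans (l1normM _ _))//.
    by rewrite mulrC ler_wpM2r ?l1norm_ge0// l1normM.
  by rewrite mulrC prodle ?absC_ge0 ?l1norm_ge0 ?ev_le.
move: d; apply: (@l1_ext R S C^o (@absC R)
  (fun d => ev (mono f k * point_proj * d) - ev (mono f k) * ev d)
  (l1norm (mono f k * point_proj) + absC (ev (mono f k)))) => // [r a b|a|g l].
- rewrite !mulrDr -!scalerAr !linearP /= mulrDr scalerBr opprD addrACA.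
  by rewrite -[X in _ - X + _]scalerAr.
- rewrite (le_trans (absCD _ _))// absCN absCM mulrDl lerD//.
    by rewrite (le_trans (ev_le _))// l1normM.
  by rewrite ler_wpM2l ?absC_ge0 ?ev_le.
rewrite !monoM !ev_mono !cfunME !alphaE indicatorE addr0.
(* If the period does not divide [k], then [orbit_char k = 0] and [sigma ^ (-k)] moves [x], so both
   terms vanish. *)
have [pk|pk] := boolP (period x %| k)%Z; last first.
  rewrite [orbit_char k]/orbit_char (negPf pk) !mul0r subr0.
  case: asboolP => [/zpow_period|_]; last by rewrite mulr0 mul0r mulr0.
  by rewrite rpredN (negPf pk).
have kx : (- k) \act x = x by apply/zpow_period; rewrite rpredN.
rewrite kx asboolT// mulr1 orbit_charD//.
by rewrite mulrACA subrr.
Qed.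

Definition ev_ideal : set A := [set a | forall b c, ev (b * a * c) = 0].

Lemma primitive_ev : primitive_ideal ev_ideal.
Proof. exact: (@primitive_functional _ _ ev point_proj ev1 evM). Qed.

Lemma ev_ideal_ev a : ev_ideal a -> ev a = 0.
Proof. by move=> /(_ 1 1); rewrite mul1r mulr1. Qed.

(** Write [ev (g * a)] as [ev (1 * e_x * (g * a))] and move [g] to the left of [e_x]. *)
Lemma ev_central g a : (forall b : A, g * b = b * g) -> ev (g * a) = ev g * ev a.
Proof.
move=> gC; rewrite -[LHS]mul1r -ev1 -evM mul1r mulrA -gC.
exact: evM.
Qed.

End evaluation.
End finite_system.

(** * Classification of primitive ideals *)

Section classification.
Variables (R : realType) (S : dynSystem).
Hypothesis finS : finite_set [set: S].
Local Notation C := (Cplx R).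
Local Notation CX := (cfun R S).
Local Notation A := (l1 R S).
Local Notation "n \act x" := (zpow (sigma S) n x) (at level 38, right associativity).
Local Notation proj x := (point_proj R finS x).

Definition orbit_shift (x : S) (k : int) : A :=
  mono (indicator R finS (zorbit (sigma S) x)) k.

Lemma orbit_shift_central x k : (period x %| k)%Z ->
  forall a, orbit_shift x k * a = a * orbit_shift x k.
Proof.
move=> pk; apply: mono_central => [y|l y].
  rewrite indicatorE; case: asboolP => [xy _|]; last by rewrite eqxx.
  by apply: (zpow_orbit xy); apply/(zpow_period finS); rewrite rpredN.
rewrite !indicatorE; congr (if _ then _ else _); apply: asbool_equiv_eq.
exact: zorbit_zpow.
Qed.

Lemma l1norm_orbit_shift x k : l1norm (orbit_shift x k) <= 1.
Proof. exact: le_trans (l1norm_mono _ _) (rnorm_indicator _ _ _). Qed.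

Lemma indicator_orbitM x k : indicator R finS (zorbit (sigma S) x) *
  alpha k (indicator R finS (zorbit (sigma S) x)) = indicator R finS (zorbit (sigma S) x).
Proof.
apply: cfunP => y; rewrite cfunME alphaE !indicatorE.
rewrite (asbool_equiv_eq (zorbit_zpow x y (- k))).
by case: ifP => _; rewrite ?mulr1 ?mulr0.
Qed.

Lemma orbit_shiftM x k l : orbit_shift x k * orbit_shift x l = orbit_shift x (k + l).
Proof. by rewrite monoM indicator_orbitM. Qed.

Lemma zorbit_refl (x : S) : zorbit (sigma S) x x.
Proof. by exists 0. Qed.

Lemma proj_shift x n k : mono (indicator R finS [set x]) n * orbit_shift x k =
  mono (indicator R finS [set x]) (n + k).
Proof.
rewrite monoM; congr mono; apply: cfunP => y; rewrite cfunME alphaE !indicatorE.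
case: asboolP => [->|_]; last by rewrite mul0r.
by rewrite asboolT ?mulr1//; apply/zorbit_zpow; exact: zorbit_refl.
Qed.

(** Between two copies of [e_x] a monomial survives only when [sigma ^ k] fixes [x]; this is what
    makes the corner commutative. *)
Lemma proj_compress x f k : proj x * mono f k * proj x =
  if (period x %| k)%Z then f x *: mono (indicator R finS [set x]) k else 0.
Proof.
rewrite !monoM add0r addr0 alpha_id.
have -> : indicator R finS [set x] * f * alpha k (indicator R finS [set x]) =
    if (period x %| k)%Z then f x *: indicator R finS [set x] else 0.
  apply: cfunP => y; rewrite !cfunME alphaE !indicatorE.
  have [pk|pk] := boolP (period x %| k)%Z.
    rewrite cfunZE indicatorE; case: asboolP => [->|_]; last by rewrite !mul0r mulr0.
    have -> : (- k) \act x = x by apply/(zpow_period finS); rewrite rpredN.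
    by rewrite asboolT// mul1r.
  rewrite cfun0E; case: asboolP => [->|_]; last by rewrite !mul0r.
  case: asboolP => [/(zpow_period finS)|_]; last by rewrite mulr0.
  by rewrite rpredN (negPf pk).
by case: ifP => _; rewrite ?monoZ ?mono0.
Qed.

Lemma sum_point_indicator :
  \sum_(x <- fset_set [set: S]) indicator R finS [set x] = 1.
Proof.
apply: cfunP => y; rewrite (big_morph (fun f : CX => f y) (id1 := 0) (op1 := +%R))//.
have yS : y \in fset_set [set: S] by rewrite in_fset_set// inE.
rewrite (big_fsetD1 y)//= asboolT// big1_fset ?addr0// => x.
by rewrite !inE => /andP[/eqP xy _] _; rewrite asboolF// => yx; apply: xy.
Qed.

Section irreducible_kernel.
Variables (E : lmodType C) (pi : representation A E).
Hypothesis pi_irr : alg_irreducible pi.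

Lemma rep_sum I (s : seq I) (F : I -> A) e :
  pi (\sum_(i <- s) F i) e = \sum_(i <- s) pi (F i) e.
Proof. by apply: (big_morph (pi^~ e)) => [a b|]; [exact: repDl|exact: rep0l]. Qed.

Lemma rep_ker_add a b : rep_ker pi a -> rep_ker pi b -> rep_ker pi (a + b).
Proof. by move=> ak bk e; rewrite repDl ak bk addr0. Qed.

(** The unit is the finite sum of the [e_x], and it acts as the identity. *)
Lemma rep_proj_neq0 : exists x, ~ rep_ker pi (proj x).
Proof.
apply: contrapT => np; have [[a [e /eqP ne]] _] := pi_irr; apply: ne.
rewrite -(rep1 pi_irr (pi a e)) mono1 -sum_point_indicator.
rewrite (big_morph (fun f : CX => mono f 0) (fun f g => monoD f g 0) (mono0 R S 0)).
rewrite rep_sum big1// => x _.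
by apply: contrapT => px; apply: np; exists x => /(_ (pi a e)).
Qed.

(** Projections of points in one orbit are conjugate under powers of [delta]. *)
Lemma rep_proj_orbit x y : zorbit (sigma S) x y ->
  rep_ker pi (proj y) -> rep_ker pi (proj x).
Proof.
move=> [k _ xy] yk e.
have -> : proj x = mono 1 (- k) * (proj y * mono 1 k).
  rewrite !monoM mul1r alpha_one mulr1 add0r addNr; congr mono.
  apply: cfunP => w; rewrite alphaE opprK !indicatorE; congr (if _ then _ else _).
  apply: asbool_equiv_eq; rewrite /= -xy; split=> [->//|].
  by move/(can_inj (zpowK (S := S) k)).
by rewrite !rep_mul yk rep0r.
Qed.

(** A central idempotent that acts nontrivially is surjective by Schur's lemma, hence acts as the
    identity. *)
Lemma orbit_shift0_id x : ~ rep_ker pi (proj x) -> forall e, pi (orbit_shift x 0) e = e.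
Proof.
move=> px e.
have [|||_ surj] := schur (T := pi (orbit_shift x 0)) pi_irr.
- exact: rep_linearr.
- by move=> a f; rewrite -!rep_mul orbit_shift_central// dvdz0.
- apply: contrapT => no; apply: px => f; rewrite -[proj x](proj_shift x 0 0) rep_mul.
  rewrite (_ : pi _ f = 0) ?rep0r//.
  by apply: contrapT => h; apply: no; exists f.
- have [f <-] := surj e; by rewrite -rep_mul orbit_shiftM.
Qed.

Lemma orbit_shift_scalar x : ~ rep_ker pi (proj x) ->
  exists la : circle R, forall e, pi (orbit_shift x (period x)) e = (val la : C) *: e.
Proof.
move=> px; have Nb := l1_banach_norm R S.
have zC : forall a e, pi (orbit_shift x (period x)) (pi a e) =
    pi a (pi (orbit_shift x (period x)) e).
  by move=> a e; rewrite -!rep_mul orbit_shift_central.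
have [|||la la1 laE] := gelfand_mazur Nb pi_irr zC (z' := orbit_shift x (- (period x)%:Z)).
- by move=> e; rewrite -rep_mul orbit_shiftM addNr orbit_shift0_id.
- exact: l1norm_orbit_shift.
- exact: l1norm_orbit_shift.
by exists (SigSub (mem_set la1)).
Qed.

(** The compression formula [pi (e_x a e_x) = ev a pi e_x] links the two ideals. As [pi e_x] is
    nonzero, [pi a = 0] forces [ev (b * a * c) = 0]; the converse uses cyclicity twice. *)
Lemma rep_ker_ev x : ~ rep_ker pi (proj x) ->
  exists la : circle R, rep_ker pi = ev_ideal x la.
Proof.
move=> px; have [la laE] := orbit_shift_scalar px; exists la.
have Nb := l1_banach_norm R S; have la0 := circle_neq0 la.
have stepE (n : int) e : pi (mono (indicator R finS [set x]) (n + (period x)%:Z)) e =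
    (val la : C) *: pi (mono (indicator R finS [set x]) n) e.
  by rewrite -proj_shift rep_mul laE repZr.
have projE (j : int) e : pi (mono (indicator R finS [set x]) (j * (period x)%:Z)) e =
    ((val la : C) ^ j) *: pi (proj x) e.
  elim/int_rect: j => [|j IH|j IH].
  - by rewrite mul0r scale1r.
  - by rewrite -addn1 PoszD mulrDl mul1r stepE IH scalerA expfzDr// expr1z mulrC.
  - apply: (scalerI la0); rewrite -stepE scalerA.
    have -> : - j.+1%:Z * period x + period x = - j%:Z * period x.
      by rewrite -addn1 PoszD opprD mulrDl mulN1r subrK.
    rewrite IH; congr (_ *: _).
    rewrite -[X in X * _]expr1z -expfzDr// -addn1 PoszD opprD addrCA subrr.
    by rewrite addr0.
(* The kernel is closed, so monomials suffice, and there only powers of [la] remain. *)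
have compress a : rep_ker pi (proj x * a * proj x - ev x la a *: proj x).
  move: a; apply: l1_ind => [|a acl|f k].
  - split=> [|c a b ak bk e].
      by rewrite mulr0 mul0r linear0 scale0r subr0 => e; exact: rep0l.
    have := rep_ker_add (a := c *: (proj x * a * proj x - ev x la a *: proj x)) _ bk.
    rewrite mulrDr mulrDl -scalerAr -scalerAl linearP scalerDl opprD addrACA.
    rewrite -scalerA -scalerBr; apply => f.
    by rewrite repZl ak scaler0.
  - apply: (rep_ker_closed Nb pi_irr) => e e0.
    have [b ab bk] := acl _ (divr_gt0 e0 (ltr0n R 2)).
    exists (proj x * b * proj x - ev x la b *: proj x) => //.
    have -> : proj x * a * proj x - ev x la a *: proj x -
        (proj x * b * proj x - ev x la b *: proj x) =
        proj x * (a - b) * proj x - ev x la (a - b) *: proj x.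
      by rewrite evB mulrBr mulrBl scalerBl !opprD !opprK addrACA.
    have p1 : l1norm (proj x) <= 1.
      exact: le_trans (l1norm_mono _ _) (rnorm_indicator _ _ _).
    have e1 : l1norm (proj x * (a - b) * proj x) <= e / 2.
      apply: le_trans (l1normM _ _) _; rewrite -[leRHS]mulr1.
      rewrite ler_pM ?l1norm_ge0// (le_trans (l1normM _ _))//.
      by rewrite -[leRHS]mul1r ler_pM ?l1norm_ge0.
    have e2 : l1norm (ev x la (a - b) *: proj x) <= e / 2.
      apply: le_trans (l1normZ_le _ _) _; rewrite -[leRHS]mulr1.
      by rewrite ler_pM ?absC_ge0 ?l1norm_ge0// (le_trans (ev_le _ _ _)).
    by rewrite (le_trans (bnB Nb _ _))// [leRHS]splitr lerD.
  - rewrite proj_compress ev_mono; case: ifP => pk e.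
      have /dvdzP[j ->] := pk; rewrite orbit_char_mul//.
      by rewrite repDl repNl !repZl projE scalerA mulrC subrr.
    by rewrite /orbit_char pk mul0r scale0r subr0 rep0l.
apply/seteqP; split=> [a ak b c|a aev v].
- apply: contrapT => /eqP evn0; apply: px => e.
  have := compress (b * a * c) e.
  rewrite repDl repNl repZl !rep_mul ak !rep0r sub0r => /eqP.
  by rewrite oppr_eq0 scaler_eq0 (negPf evn0) => /eqP.
(* If [pi a v] were nonzero, [c] would carry it to [w] and [f] would carry [pi e_x w] back to [v],
   making [pi e_x w] the image of [w] under [e_x c a f e_x], which acts as zero. *)
- have [w pw] : exists w, pi (proj x) w <> 0.
    by apply: contrapT => nw; apply: px => w; apply: contrapT => pw; apply: nw; exists w.
  apply: contrapT => av; apply: pw.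
  have [c ->] := rep_cyclic pi_irr w av; apply: contrapT => pcv.
  have [f vf] := rep_cyclic pi_irr v pcv.
  apply: pcv; rewrite {1}vf.
  have := compress (c * a * f) (pi c (pi a v)).
  rewrite aev scale0r subr0 !rep_mul; apply.
Qed.

End irreducible_kernel.
End classification.

(** * Separation of points *)

Section separation.
Variables (R : realType) (S : dynSystem).
Hypothesis finS : finite_set [set: S].
Local Notation C := (Cplx R).
Local Notation A := (l1 R S).
Local Notation shift x k := (orbit_shift R finS x k).

Lemma ev_orbit_shift x la k :
  ev x la (shift x k) = orbit_char x la k.
Proof. by rewrite ev_mono indicatorE asboolT ?mulr1//; exact: zorbit_refl. Qed.

(** The indicators of two disjoint orbits are central idempotents with product zero. *)
Lemma ev_separates_orbits x y la mu : ~ zorbit (sigma S) x y ->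
  exists g h : A, [/\ forall c, g * c * h = 0, ev x la g != 0 & ev y mu h != 0].
Proof.
move=> xy; exists (shift x 0), (shift y 0); split=> [c||].
- rewrite orbit_shift_central ?dvdz0// -mulrA monoM alpha_id.
  suff -> : indicator R finS (zorbit (sigma S) x) * indicator R finS (zorbit (sigma S) y) = 0.
    by rewrite mono0 mulr0.
  apply: cfunP => w; rewrite cfunME !indicatorE cfun0E.
  case: asboolP => [[k _ xw]|_]; last by rewrite mul0r.
  case: asboolP => [[l _ yw]|_]; last by rewrite mulr0.
  exfalso; apply: xy; apply/(zorbit_zpow x y l); rewrite yw -xw.
  by exists k.
- by rewrite ev_orbit_shift orbit_char0// oner_eq0.
- by rewrite ev_orbit_shift orbit_char0// oner_eq0.
Qed.

Lemma circle_conj (z : C) : absC z = 1 -> Num.conj z = z^-1.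
Proof.
move=> z1; have z0 := absC1_neq0 z1.
apply: (mulfI z0); rewrite mulfV// -normCK -absCE z1.
by rewrite expr1n.
Qed.

(* [om] is the direction of [la - mu]; on the circle, [z / om + om / z] is twice
   the real part of [z / om]. *)
Lemma circle_separation (la mu : C) : absC la = 1 -> absC mu = 1 -> la != mu ->
  exists (om : C) (r : R), [/\ absC om = 1, 0 < r,
    la / om + om / la = r%:C & mu / om + om / mu = - r%:C].
Proof.
move=> la1 mu1 lamu; have la0 := absC1_neq0 la1; have mu0 := absC1_neq0 mu1.
have d0 : la - mu != 0 by rewrite subr_eq0.
pose r := absC (la - mu); have r0 : r != 0.
  by apply: contra_neq d0; exact: absC_eq0.
have rC : (r%:C : C) != 0 by apply: contra_neq r0; exact: complexI.
have r2 : (r%:C : C) ^+ 2 = (la - mu) * (la^-1 - mu^-1).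
  have conjB : Num.conj (la - mu) = Num.conj la - Num.conj mu by exact: rmorphB.
  by rewrite absCE normCK conjB !circle_conj.
exists ((la - mu) / r%:C), r; split.
- by rewrite absCM absCV absC_real ger0_norm ?absC_ge0// mulfV.
- by rewrite lt_neqAle eq_sym r0 absC_ge0.
- apply: (mulfI rC); rewrite -expr2 r2 invf_div.
  have -> : r%:C * (la * (r%:C / (la - mu)) + (la - mu) / r%:C / la) =
    la * (r%:C ^+ 2 / (la - mu)) + (la - mu) / la by field; rewrite rC la0 d0.
  by rewrite r2; field; rewrite mu0 la0 d0.
- apply: (mulfI rC); rewrite mulrN -expr2 invf_div.
  have -> : r%:C * (mu * (r%:C / (la - mu)) + (la - mu) / r%:C / mu) =
    mu * (r%:C ^+ 2 / (la - mu)) + (la - mu) / mu by field; rewrite rC mu0 d0.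
  by rewrite r2; field; rewrite mu0 la0 d0.
Qed.

(* A square root [1 - q] of [t ^ 2] with [|q| <= 1] has nonnegative real part,
   hence is [- t] when [t] is negative. *)
Lemma sqrt_branch (q t : C) (r : R) : (1 - q) ^+ 2 = t ^+ 2 -> absC q <= 1 ->
  0 < r -> t = - r%:C -> 1 - q = - t.
Proof.
move=> qt q1 r0 tr; have /eqP := qt; rewrite eqf_sqr => /orP[/eqP qE|/eqP//].
have : q = (1 + r)%:C :> C.
  have -> : q = 1 - t by rewrite -qE subKr.
  by rewrite tr opprK rmorphD rmorph1.
move=> qr; move: q1; rewrite qr absC_real ger0_norm; last by rewrite addr_ge0 ?ltW.
by rewrite gerDl leNgt r0.
Qed.

(* With [t] the element of [ev]-transform [Re (z / om)] and [s] a square root of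
   [t ^ 2] of [ev]-transform [|Re (z / om)|], the elements [s + t] and [s - t]
   have product 0 on the orbit and live on opposite half circles. *)
Lemma ev_separates_circle x (la mu : circle R) : la != mu ->
  exists g h : A, [/\ forall c, g * c * h = 0, ev x la g != 0 & ev x mu h != 0].
Proof.
move=> lamu; have Nb := l1_banach_norm R S.
have lamu' : (val la : C) != val mu by apply: contra_neq lamu; exact: val_inj.
have [om [r [om1 r0 omla ommu]]] :=
  circle_separation (absC_circle la) (absC_circle mu) lamu'.
have om0 := absC1_neq0 om1.
pose p : int := period x; pose e := shift x 0.
pose a : C := om^-1 / 2; pose b : C := om / 2.
have a2 := @absC_half R.
have a12 : absC a = 1 / 2 by rewrite absCM (absCV om) om1 invr1 a2 !mul1r.
have b12 : absC b = 1 / 2 by rewrite absCM om1 a2 !mul1r.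
have ab : a * b + a * b = 2^-1 by rewrite /a /b; field.
have [aE bE] : a = om^-1 / 2 /\ b = om / 2 by [].
clearbody a b.
pose t := a *: shift x p + b *: shift x (- p).
have pp : (period x %| p)%Z by exact: dvdzz.
have pN : (period x %| - p)%Z by rewrite rpredN; exact: pp.
have eC c : e * c = c * e by rewrite orbit_shift_central// dvdz0.
have tC c : t * c = c * t.
  by rewrite mulrDl mulrDr -!scalerAl -!scalerAr !orbit_shift_central.
have ttE : t * t = (a * a) *: shift x (p + p) + (a * b + a * b) *: e +
    (b * b) *: shift x (- p - p).
  rewrite mulrDl !mulrDr -!scalerAl -!scalerAr !orbit_shiftM !scalerA.
  by rewrite subrr addNr [b * a]mulrC addrA -[X in X + _]addrA -scalerDl.
pose u := e - t * t; have uE : u = e - t * t by [].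
(* The coefficients of [u] have moduli 1/2, 1/4 and 1/4: their sum 1 is just what the square root
   allows. *)
have u1 : l1norm u <= 1.
  have -> : u = (2^-1 : C) *: e - ((a * a) *: shift x (p + p) + (b * b) *: shift x (- p - p)).
    rewrite /u ttE ab addrAC [_ + 2^-1 *: e]addrC opprD addrA; congr (_ - _).
    by rewrite -{1}(scale1r e) -scalerBl; congr (_ *: _); field.
  have n1 k : l1norm (shift x k) <= 1 by exact: l1norm_orbit_shift.
  have zle (c : C) k m : absC c <= m -> l1norm (c *: shift x k) <= m.
    move=> cm; apply: le_trans (l1normZ_le _ _) _; apply: le_trans cm.
    by rewrite ler_piMr ?absC_ge0.
  have z1 := zle (2^-1 : C) 0 (1 / 2); have z2 := zle (a * a) (p + p) (1 / 4).
  have z3 := zle (b * b) (- p - p) (1 / 4).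
  have := bnB Nb ((2^-1 : C) *: e) ((a * a) *: shift x (p + p) + (b * b) *: shift x (- p - p)).
  have := bnD Nb ((a * a) *: shift x (p + p)) ((b * b) *: shift x (- p - p)).
  move: z1 z2 z3; rewrite !absCM a2 a12 b12 => /(_ (lexx _)) z1 z2 z3.
  have {}z2 := z2 ltac:(lra); have {}z3 := z3 ltac:(lra).
  lra.
have [q [q2 q1 qC]] := sqrt_one_minus Nb u1.
have uC c : u * c = c * u.
  by rewrite mulrBl mulrBr eC -mulrA (tC (t * c)) (tC c) mulrA.
have {}qC c : q * c = c * q by rewrite -qC.
pose s := 1 - q; have sC c : s * c = c * s by rewrite mulrBl mulrBr mul1r mulr1 qC.
(* [u] is central and [q] inherits this, so [ev] is multiplicative here; as [ev e = 1], [1 - ev u]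
   equals the square of [ev t]. *)
have evs (nu : circle R) : (1 - ev x nu q) ^+ 2 = ev x nu t ^+ 2.
  have -> : 1 - ev x nu q = ev x nu s by rewrite /s evB ev1.
  rewrite !expr2 -!ev_central// -expr2 q2 evB// ev1// /u evB// /e ev_orbit_shift.
  by rewrite orbit_char0// opprB addrC subrK.
have evt (nu : circle R) : ev x nu t = (val nu / om + om / val nu) / 2.
  have pE : p = 1 * p by rewrite mul1r.
  have pNE : - p = -1 * p by rewrite mulN1r.
  rewrite /t evD !evZ !ev_orbit_shift [in orbit_char _ _ p]pE pNE !orbit_char_mul//.
  by rewrite aE bE expr1z exprN1; field; rewrite om0 circle_neq0.
have eve nu : ev x nu e = 1.
  by rewrite /e ev_orbit_shift orbit_char0.
have q1' nu : absC (ev x nu q) <= 1 by exact: le_trans (ev_le _ _ _) q1.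
have ssE : s * s = 1 - u by rewrite -expr2.
have evsE nu : ev x nu s = 1 - ev x nu q by rewrite /s evB ev1.
have r2_gt0 : 0 < r / 2 by rewrite divr_gt0.
have r2_neq0 : ((r / 2)%:C : C) != 0.
  by apply/eqP => /complexI r20; rewrite r20 ltxx in r2_gt0.
clearbody s t u.
exists (e * (s + t)), (e * (s - t)); split.
- move=> c.
  have -> : e * (s + t) * c = c * (e * (s + t)).
    by rewrite -mulrA mulrDl sC tC -mulrDr mulrA eC mulrA.
  have -> : c * (e * (s + t)) * (e * (s - t)) = c * (e * e * ((s + t) * (s - t))).
    by rewrite !mulrA -[c * e * (s + t) * e]mulrA -[(s + t) * e]eC !mulrA.
  (* Indeed [s ^ 2 = 1 - u = 1 - e + t ^ 2], and the factor [1 - e] is killed by [e]. *)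
  have -> : (s + t) * (s - t) = 1 - e.
    rewrite mulrDl !mulrBr -(tC s) addrA subrK ssE uE opprB.
    by rewrite addrA addrAC addrK.
  by rewrite orbit_shiftM mulrBr mulr1 orbit_shiftM subrr mulr0.
- have tla : - ev x la t = - (r / 2)%:C.
    by rewrite evt omla rmorphM fmorphV rmorph_nat.
  (* At [la] the branch is applied to [- t], giving [ev s = ev t] and [ev (s + t) = r]; at [mu] it
     is applied to [t]. *)
  have := sqrt_branch (t := - ev x la t) _ (q1' la) r2_gt0 tla.
  rewrite sqrrN evs opprK => /(_ erefl) sla.
  rewrite ev_central// eve mul1r evD evsE sla -mulr2n mulrn_eq0 /=.
  by rewrite -[ev x la t]opprK tla opprK.
- have tmu : ev x mu t = - (r / 2)%:C.
    by rewrite evt ommu rmorphM fmorphV rmorph_nat mulNr.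
  have := sqrt_branch (evs mu) (q1' mu) r2_gt0 tmu => smu.
  rewrite ev_central// eve mul1r evB evsE smu -opprD oppr_eq0 -mulr2n mulrn_eq0 /=.
  by rewrite tmu oppr_eq0.
Qed.

End separation.

(** * The structure space *)

Lemma compact_hausdorff_homeomorphic (T U : topologicalType) (f : T -> U) :
  compact [set: T] -> hausdorff_space U -> continuous f -> bijective f ->
  homeomorphic U T.
Proof.
move=> cT hU fc [g fK gK].
have gc : continuous g.
  apply/continuous_closedP => B Bcl.
  have -> : g @^-1` B = f @` B.
    apply/seteqP; split=> [u Bu|_ [t Bt <-]]; first by exists (g u).
    by rewrite /= fK.
  apply: compact_closed => //; apply: continuous_compact.
    exact: continuous_subspaceT.
  exact: subclosed_compact Bcl cT _.
by split; exact: (Homeomorphism gK fK gc fc).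
Qed.

(** A near covering of the subtype becomes one of [B] by quantifying over membership proofs; open
    sets of the subtype are traces of open sets of [T]. *)
Lemma compact_set_typeT (T : topologicalType) (B : set T) :
  compact B -> compact [set: set_type B].
Proof.
move=> /compact_near_coveringP cB; apply/compact_near_coveringP => I F P FF cov.
have : \forall i \near F, B `<=` [set x | forall xB : x \in B, P i (exist _ x xB)].
  apply: cB => x Bx.
  have [[U V] [/= + FV] UV] := cov (exist _ x (mem_set Bx)) Logic.I.
  rewrite nbhsE => -[W [oW Wx] WU]; case: oW => O oO OW; rewrite -OW in Wx WU.
  exists (O, V) => /=; first by split=> //; apply: open_nbhs_nbhs; split.
  move=> [y i] /= [Oy Vi] yB; apply: (UV (exist _ y yB, i)); split=> //=.
  exact: WU.
apply: filterS => i Bi [x xB] _; exact: Bi (set_mem xB) xB.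
Qed.

Section structure_space.
Variables (R : realType) (S : dynSystem).
Hypothesis finS : finite_set [set: S].
Local Notation C := (Cplx R).
Local Notation A := (l1 R S).

Lemma exprz_comp_continuous (T : topologicalType) (f : T -> C) (n : int) :
  continuous f -> (forall t, f t != 0) -> continuous (fun t => f t ^ n).
Proof.
move=> fc f0; have expc m : continuous (fun t => f t ^+ m).
  elim: m => [|m IH] t; first by apply: cvg_cst.
  have -> : (fun u => f u ^+ m.+1) = (fun u => f u * f u ^+ m).
    by apply/funext => u; rewrite exprS.
  exact: cvgM (fc t) (IH t).
case: n => m t; first exact: expc.
by apply: cvgV (expc m.+1 t); rewrite expf_neq0.
Qed.

(** The bound [absC (ev a) <= l1norm a] is uniform in [la], so continuity passes to norm limits; on
    monomials [ev] is a constant times a power of [la], or zero. *)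
Lemma ev_comp_continuous (T : topologicalType) (la : T -> circle R) x (a : A) :
  continuous (fun t => val (la t) : C) -> continuous (fun t => ev x (la t) a).
Proof.
move=> lac; move: a; apply: l1_ind => [|a acl|f k].
- split=> [|c a b ac bc] t.
    have -> : (fun t => ev x (la t) 0) = (fun=> 0 : C).
      by apply/funext => u; rewrite -(subrr 0) evB subrr.
    exact: cvg_cst.
  have -> : (fun t => ev x (la t) (c *: a + b)) =
      (fun t => c * ev x (la t) a + ev x (la t) b).
    by apply/funext => u; rewrite evD evZ.
  exact: cvgD (cvgM (cvg_cst c) (ac t)) (bc t).
- move=> t; apply/(@cvgrPdist_lt _ _ _ (nbhs t)) => _ /gt0C[e e0 ->].
  have e3 : 0 < e / 3 by rewrite divr_gt0.
  have e3e : e / 3 + e / 3 + e / 3 = e by field.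
  have [b ab bc] := acl _ e3.
  have e3C : (0 : C) < (e / 3)%:C by rewrite ltcR.
  have /(@cvgrPdist_lt _ _ _ (nbhs t))/(_ _ e3C) := bc t.
  apply: filterS => u; rewrite -!absCE !ltcR => tu.
  have -> : ev x (la t) a - ev x (la u) a =
      (ev x (la t) (a - b) - ev x (la u) (a - b)) + (ev x (la t) b - ev x (la u) b).
    rewrite !evB; move: (ev x (la t) a) (ev x (la t) b) (ev x (la u) a) (ev x (la u) b) => p q p' q'.
    by rewrite (opprD p') (addrACA p (- q)) -(opprD q) subrK.
  apply: le_lt_trans (absCD _ _) _.
  rewrite -e3e ler_ltD// (le_trans (absCD _ _))// absCN.
  by rewrite lerD// (le_trans (ev_le _ _ _)).
- have [pk|/negPf pk] := boolP (period x %| k)%Z.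
    have -> : (fun t => ev x (la t) (mono f k)) =
        (fun t => (val (la t) : C) ^ (k %/ period x)%Z * f x).
      by apply/funext => u; rewrite ev_mono /orbit_char pk.
    have pc : continuous (fun u => (val (la u) : C) ^ (k %/ period x)%Z).
      by apply: exprz_comp_continuous => // u; exact: circle_neq0.
    by move=> t; exact: cvgM (pc t) (cvg_cst (f x)).
  have -> : (fun t => ev x (la t) (mono f k)) = (fun=> 0 : C).
    by apply/funext => u; rewrite ev_mono /orbit_char pk mul0r.
  by move=> t; exact: cvg_cst.
Qed.

Lemma ev_continuous x (a : A) : continuous (fun la : circle R => ev x la a).
Proof. apply: (@ev_comp_continuous (circle R) id); exact: initial_continuous. Qed.

Definition orbit_rep (O : orbit_space S) : S := s2val (cid2 (set_valP O)).

Lemma orbit_repE O : zorbit (sigma S) (orbit_rep O) = val O.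
Proof. exact: (s2valP' (cid2 (set_valP O))). Qed.

Definition primitive_point (O : orbit_space S) (la : circle R) : structure_space A :=
  SigSub (mem_set (primitive_ev finS (orbit_rep O) la)).

(** The preimage of a hull is an intersection of zero sets of the continuous functions
    [la |-> ev la (b * a * c)]. *)
Lemma primitive_point_continuous O : continuous (primitive_point O).
Proof.
apply/continuous_closedP => B /closure_id; rewrite closure_structure_space => ->.
have -> : primitive_point O @^-1` hk_closure B =
    \bigcap_(a in \bigcap_(Q in B) val Q) \bigcap_b \bigcap_c
      ((fun la : circle R => ev (orbit_rep O) la (b * a * c)) @^-1` [set 0]).
  apply/seteqP; split=> la h a.
    by move=> aB b _ c _; exact: h.
  by move=> aB b c; exact: h.
apply: closed_bigI => a _; apply: closed_bigI => b _; apply: closed_bigI => c _.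
apply: preimage_closed => [la _|]; first exact: ev_continuous.
apply: accessible_closed_set1; apply: hausdorff_accessible; exact: norm_hausdorff.
Qed.

Definition primitive_param (w : {_ : orbit_space S & circle R}) : structure_space A :=
  unstable.sigT_fun primitive_point w.

Lemma primitive_param_continuous : continuous primitive_param.
Proof.
move=> [i la] U nU; change (nbhs la (primitive_point i @^-1` U)).
exact: primitive_point_continuous nU.
Qed.

(** This gives both injectivity and the Hausdorff property: primitive ideals are prime, so each
    contains [g] or [h]. *)
Lemma primitive_param_separated w w' : w != w' -> exists g h : A,
  [/\ forall c, g * c * h = 0, ~ val (primitive_param w) g & ~ val (primitive_param w') h].
Proof.
case: w w' => [i la] [j la'] ww'.
suff [g [h [gh evg evh]]] : exists g h : A, [/\ forall c, g * c * h = 0,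
    ev (orbit_rep i) la g != 0 & ev (orbit_rep j) la' h != 0].
  exists g, h; split=> // /ev_ideal_ev /eqP; first by rewrite (negPf evg).
  by rewrite (negPf evh).
have [ij|ij] := eqVneq i j.
  subst j; apply: ev_separates_circle => //.
  by apply: contra_neq ww' => ->.
apply: ev_separates_orbits => // -[k _ kE]; case/eqP: ij; apply: val_inj.
rewrite -!orbit_repE -kE; apply/seteqP; split=> y.
  by move=> [l _ <-]; exists (l - k) => //; rewrite -zpowD subrK.
by move=> [l _ <-]; exists (l + k) => //; rewrite zpowD.
Qed.

Lemma primitive_param_inj : injective primitive_param.
Proof.
move=> w w' ww'; apply/eqP; apply: contrapT => /negP.
move=> /primitive_param_separated[g [h [gh gw hw]]].
have [c|//|] := primitive_prime (a := g) (b := h) (set_valP (primitive_param w)).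
  have [E [pi [_ ->]]] := set_valP (primitive_param w).
  by move=> e; rewrite gh rep0l.
by rewrite ww'.
Qed.

Lemma primitive_param_surj P : exists w, primitive_param w = P.
Proof.
have [E [pi [pi_irr PE]]] := set_valP P.
have [y py] := rep_proj_neq0 finS pi_irr.
pose O : orbit_space S := SigSub (mem_set (ex_intro2 _ _ y Logic.I erefl)).
have [la laE] : exists la : circle R, rep_ker pi = ev_ideal (orbit_rep O) la.
  (* The chosen representative of the orbit may differ from [y]; conjugacy of the projections
     carries the nonvanishing over to it. *)
  apply: (rep_ker_ev (finS := finS) pi_irr) => px; apply: py.
  apply: (rep_proj_orbit (finS := finS) (y := orbit_rep O)) => //.
  rewrite -[zorbit _ y]/(val O) -orbit_repE; exact: zorbit_refl.
exists (existT _ O la); apply: val_inj => /=.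
by rewrite PE laE.
Qed.

(** The ideals omitting [g] and those omitting [h] form open sets, disjoint by primeness. *)
Lemma hausdorff_primitive : hausdorff_space (structure_space A).
Proof.
rewrite open_hausdorff => P Q PQ.
have [w wP] := primitive_param_surj P; have [w' wQ] := primitive_param_surj Q.
have [|g [h [gh Pg Qh]]] := @primitive_param_separated w w'.
  by apply: contra_neq PQ => ww'; rewrite -wP -wQ ww'.
rewrite wP in Pg; rewrite wQ in Qh.
have hk (a : A) : open [set P : structure_space A | ~ val P a].
  apply: (_ : hk_open _) => P0 P0cl nP0; apply: nP0; apply: P0cl => Q0.
  exact: contrapT.
exists ([set P : structure_space A | ~ val P g], [set P : structure_space A | ~ val P h]).
  by split; rewrite inE.
split; [exact: hk|exact: hk|].
apply/eqP/seteqP; split=> // P0 [/= nPg nPh].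
have [c|//|//] := primitive_prime (a := g) (b := h) (set_valP P0).
have [E [pi [_ ->]]] := set_valP P0.
by move=> e; rewrite gh rep0l.
Qed.

Lemma compact_orbit_circles : compact [set: {_ : orbit_space S & circle R}].
Proof.
apply: sigT_compact => [|_]; last exact: compact_set_typeT (@compact_circle R).
pose f (x : S) : orbit_space S :=
  SigSub (mem_set (ex_intro2 _ _ x Logic.I erefl)).
have -> : [set: orbit_space S] = f @` [set: S].
  apply/seteqP; split=> // O _; have [x _ xO] := set_valP O.
  by exists x => //; apply: val_inj.
exact: finite_image.
Qed.

End structure_space.

Theorem corollary5p11 (R : realType) (S : dynSystem)
    (finS : finite_set [set: S]%classic) :
  homeomorphic (structure_space (l1 R S)) {_ : orbit_space S & circle R}.
Proof.
apply: (compact_hausdorff_homeomorphic (f := primitive_param finS)).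
- exact: compact_orbit_circles.
- exact: hausdorff_primitive.
- exact: primitive_param_continuous.
- have gK P := projT2 (cid (primitive_param_surj finS P)).
  exists (fun P => projT1 (cid (primitive_param_surj finS P))) => // w.
  apply: (@primitive_param_inj R S finS); exact: gK.
Qed.
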